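(* Let $f:\mathbb{R}^d\to\mathbb{R}$ be Lipschitz continuous at (i.e. near) $\bar x$, and let $\bar x$ be a local solution of the problem $\min_x f(x)$ subject to $x\in\mathcal{F}$, where $\mathcal{F}=\{x\in\mathbb{R}^d: g(x)\le 0,\ h(x)=0,\ \Phi_i(x)\in\Gamma_i,\ i=1,\dots,l\}$ with $g$ locally Lipschitz, $h,\Phi_1,\dots,\Phi_l$ smooth and each $\Gamma_i\subseteq\mathbb{R}^{p_i}$ a union of finitely many convex polyhedral sets. Suppose that MPDC-RCPLD holds at $\bar x$. Then $\bar x$ is a Mordukhovich (M-)stationary point, i.e. there exists $(\lambda^g,\lambda^h,\bar\eta)\in\mathbb{R}^n\times\mathbb{R}^m\times\prod_{i=1}^l\mathbb{R}^{p_i}$ such that $$0\in\partial f(\bar x)+\sum_{i\in\bar I_g}\lambda_i^g\,\partial g_i(\bar x)+\sum_{i=1}^m\lambda_i^h\nabla h_i(\bar x)+\sum_{i=1}^l\nabla\Phi_i(\bar x)^T\bar\eta_i,$$ $$\lambda_i^g\ge 0\ (i\in\bar I_g),\qquad \bar\eta_i\in\mathcal{N}_{\Gamma_i}(\Phi_i(\bar x))\ (i=1,\dots,l),$$ where $\bar I_g=\{i: g_i(\bar x)=0\}$.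
   Context: Setting. $g=(g_1,\dots,g_n):\mathbb{R}^d\to\mathbb{R}^n$ is locally Lipschitz continuous; $h=(h_1,\dots,h_m):\mathbb{R}^d\to\mathbb{R}^m$ and $\Phi_i:\mathbb{R}^d\to\mathbb{R}^{p_i}$ ($i=1,\dots,l$) are smooth (continuously differentiable); each $\Gamma_i\subseteq\mathbb{R}^{p_i}$ is a disjunctive set, i.e. a union of finitely many convex polyhedral sets. The disjunctive system is $g(x)\le0$, $h(x)=0$, $\Phi_i(x)\in\Gamma_i$ ($i=1,\dots,l$), with solution set $\mathcal{F}$. $\partial$ is the limiting (Mordukhovich) subdifferential; $\widehat{\mathcal N}_C$ and $\mathcal{N}_C$ are the regular (Fréchet) and limiting (Mordukhovich) normal cones. $\nabla h_i$ is the gradient (column vector), $\nabla\Phi_i(x)$ the Jacobian matrix, and $\bar I_g:=\{i:g_i(\bar x)=0\}$ for $\bar x\in\mathcal F$. Generators. For finite sets $A^I,A^E$ of vectors put $\mathcal{G}(A^I,A^E):=\mathrm{cone}(A^I)+\mathrm{span}(A^E)$ (cone = generated convex cone; both are $\{0\}$ for the empty set). A generator of a convex polyhedral cone $D$ is a pair $(A^I,A^E)$ of finite disjoint sets, with the vectors in $A^E$ linearly independent, such that $D=\mathcal{G}(A^I,A^E)$ and $A^I\cup A^E$ has the minimal possible number of vectors (for $D=\{0\}$ one takes $A^I\cup A^E=\{0\}$). If $\Gamma$ is a disjunctive set and $x\in\Gamma$, then $\widehat{\mathcal N}_\Gamma(x)$ is a convex polyhedral cone; fix a generator $(\widehat A^I_\Gamma(x),\widehat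 A^E_\Gamma(x))$ of it (the same generator for equal cones). For $\bar y\in\Gamma$ there is $\delta>0$ (taken sufficiently small) with $\mathcal{N}_\Gamma(\bar y)=\bigcup_{x\in\mathbb{B}_\delta(\bar y)\cap\Gamma}\widehat{\mathcal N}_\Gamma(x)$, and one sets $A^I_\Gamma(\bar y):=\bigcup_{x\in\mathbb{B}_\delta(\bar y)\cap\Gamma}\widehat A^I_\Gamma(x)$, $A^E_\Gamma(\bar y):=\bigcup_{x\in\mathbb{B}_\delta(\bar y)\cap\Gamma}\widehat A^E_\Gamma(x)$ (finite sets). MPDC-RCPLD. A point $\bar x\in\mathcal F$ satisfies MPDC-RCPLD for the disjunctive system if: (i) $\{\nabla h_i(x)\}_{i=1}^m$ has constant rank for all $x$ in a neighborhood of $\bar x$. (ii) Let $J\subseteq\{1,\dots,m\}$ be such that $\{\nabla h_i(\bar x)\}_{i\in J}$ is a basis of $\mathrm{span}\{\nabla h_i(\bar x)\}_{i=1}^m$. Whenever there exist $I\subseteq\bar I_g$, a nonzero vector $(\lambda^h,\lambda^g,\bar\eta)\in\mathbb{R}^m\times\mathbb{R}^n\times\prod_{i=1}^l\mathbb{R}^{p_i}$ (with $\lambda^h_i=0$ for $i\notin J$, $\lambda^g_i=0$ for $i\notin I$) with $\lambda^g_i\ge0$, vectors $v_i\in\partial g_i(\bar x)$ $(i\in I)$ and $\bar\eta_i\in\mathcal{N}_{\Gamma_i}(\Phi_i(\bar x))$ $(i=1,\dots,l)$ such that $$0=\sum_{i\in I}\lambda_i^gv_i+\sum_{i\in J}\lambda_i^h\nabla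 h_i(\bar x)+\sum_{i=1}^l\nabla\Phi_i(\bar x)^T\bar\eta_i,$$ then for all sufficiently large $k$ the family $$\{v_i^k\}_{i\in I}\cup\{\nabla h_i(x^k)\}_{i\in J}\cup\bigcup_{i\in\{1,\dots,l\},\ \beta_i\in A_i^I\cup A_i^E}\{\nabla\Phi_i(x^k)^T\beta_i\}$$ is linearly dependent, for any sequences $x^k\to\bar x$, $x^k\ne\bar x$, $v_i^k\in\partial g_i(x^k)$, $v_i^k\to v_i$ $(i\in I)$, and any sets $A_i^I\subseteq A^I_{\Gamma_i}(\Phi_i(\bar x))$, $A_i^E\subseteq A^E_{\Gamma_i}(\Phi_i(\bar x))$ with $A_i^I\cup A_i^E$ linearly independent and $\bar\eta_i\in\mathcal{G}(A_i^I,A_i^E)\subseteq\mathcal{N}_{\Gamma_i}(\Phi_i(\bar x))$ if $\bar\eta_i\ne0$, and $A_i^I\cup A_i^E=\emptyset$ if $\bar\eta_i=0$. *)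

(* Defs.v *)
From HB Require Import structures.
From mathcomp Require Import all_boot all_order all_algebra finmap.
From mathcomp Require Import all_classical all_reals all_analysis.

Set Implicit Arguments.
Unset Strict Implicit.
Unset Printing Implicit Defensive.

Import Order.TTheory GRing.Theory Num.Theory.
Import numFieldNormedType.Exports.

Local Open Scope classical_set_scope.
Local Open Scope ring_scope.

(* Vectors of R^d are row vectors 'rV[R]_d. The norm `|x| on 'rV[R]_d, and the
   balls, are the library's sup norm ones; the o(|y - x|) and Lipschitz
   conditions below do not depend on which norm of R^d is used. *)

Definition dot (R : realType) (d : nat) (u v : 'rV[R]_d) : R :=
  \sum_(j < d) u 0 j * v 0 j.

Definition lipschitz_near (R : realType) (d : nat) (W : normedModType R)
    (f : 'rV[R]_d -> W) (x : 'rV[R]_d) : Prop :=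
  exists2 U, nbhs x U & [lipschitz f y | y in U].

Definition locally_lipschitz (R : realType) (d : nat) (W : normedModType R)
    (f : 'rV[R]_d -> W) : Prop :=
  forall x, lipschitz_near f x.

Definition continuously_differentiable (R : realType) (d q : nat)
    (F : 'rV[R]_d -> 'rV[R]_q) : Prop :=
  (forall x, differentiable F x) /\ continuous (fun x => 'J F x).

(* The library's 'J F x acts on row vectors from the right,
   'd F x u = u *m 'J F x, so it is the d x q transpose of the usual q x d
   Jacobian matrix, and the gradient of F_i is its i-th column. *)
Definition gradient (R : realType) (d q : nat) (F : 'rV[R]_d -> 'rV[R]_q)
    (x : 'rV[R]_d) (i : 'I_q) : 'rV[R]_d :=
  (col i ('J F x))^T.

(* The vector (nabla F(x))^T eta, written as a row vector. *)
Definition adjoint_jacobian (R : realType) (d q : nat)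
    (F : 'rV[R]_d -> 'rV[R]_q) (x : 'rV[R]_d) (eta : 'rV[R]_q) : 'rV[R]_d :=
  eta *m ('J F x)^T.

Definition frechet_subdifferential (R : realType) (d : nat)
    (f : 'rV[R]_d -> R) (x : 'rV[R]_d) : set 'rV[R]_d :=
  [set v | forall e : R, 0 < e ->
     \forall y \near x, f x + dot v (y - x) - e * `|y - x| <= f y].

Definition limiting_subdifferential (R : realType) (d : nat)
    (f : 'rV[R]_d -> R) (x : 'rV[R]_d) : set 'rV[R]_d :=
  [set v | exists (xk vk : nat -> 'rV[R]_d),
     [/\ xk @ \oo --> x,
         (fun k => f (xk k)) @ \oo --> f x,
         vk @ \oo --> v &
         forall k, frechet_subdifferential f (xk k) (vk k)]].

Definition regular_normal_cone (R : realType) (d : nat) (C : set 'rV[R]_d)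
    (x : 'rV[R]_d) : set 'rV[R]_d :=
  [set v | C x /\ forall e : R, 0 < e ->
     \forall y \near x, C y -> dot v (y - x) <= e * `|y - x|].

Definition limiting_normal_cone (R : realType) (d : nat) (C : set 'rV[R]_d)
    (x : 'rV[R]_d) : set 'rV[R]_d :=
  [set v | C x /\ exists (xk vk : nat -> 'rV[R]_d),
     [/\ xk @ \oo --> x,
         vk @ \oo --> v,
         forall k, C (xk k) &
         forall k, regular_normal_cone C (xk k) (vk k)]].

Definition polyhedral (R : realType) (q : nat) (C : set 'rV[R]_q) : Prop :=
  exists (k : nat) (a : 'I_k -> 'rV[R]_q) (b : 'I_k -> R),
    C = [set y | forall i, dot (a i) y <= b i].

Definition disjunctive_set (R : realType) (q : nat) (G : set 'rV[R]_q) : Prop :=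
  exists (N : nat) (C : 'I_N -> set 'rV[R]_q),
    (forall r, polyhedral (C r)) /\ G = \bigcup_r C r.

Definition generated_cone (R : realType) (q : nat) (A : {fset 'rV[R]_q}) :
    set 'rV[R]_q :=
  [set \sum_(a <- enum_fset A) c a *: a
     | c in [set c : 'rV[R]_q -> R | forall a, 0 <= c a]].

Definition cone_plus_span (R : realType) (q : nat)
    (AI AE : {fset 'rV[R]_q}) : set 'rV[R]_q :=
  [set u + w | u in generated_cone AI
             & w in [set w | w \in <<enum_fset AE>>%VS]].

Definition pre_generator (R : realType) (q : nat) (D : set 'rV[R]_q)
    (AI AE : {fset 'rV[R]_q}) : Prop :=
  [/\ [disjoint AI & AE]%fset,
      free (enum_fset AE) &
      D = cone_plus_span AI AE].

Definition is_generator (R : realType) (q : nat) (D : set 'rV[R]_q)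
    (AI AE : {fset 'rV[R]_q}) : Prop :=
  [/\ pre_generator D AI AE,
      D = [set 0] -> (AI `|` AE = [fset 0])%fset &
      D <> [set 0] -> forall BI BE : {fset 'rV[R]_q}, pre_generator D BI BE ->
        (#|` (AI `|` AE)%fset| <= #|` (BI `|` BE)%fset|)%N].

(* A choice of a pair (A^I, A^E) for every cone. Since it is a function of the
   cone, equal cones receive the same pair. *)
Definition generator_choice (R : realType) : Type :=
  forall q : nat, set 'rV[R]_q -> {fset 'rV[R]_q} * {fset 'rV[R]_q}.

Definition generator_choice_for (R : realType) (gen : generator_choice R)
    (q : nat) (G : set 'rV[R]_q) : Prop :=
  forall x, G x ->
    is_generator (regular_normal_cone G x)
      (gen q (regular_normal_cone G x)).1 (gen q (regular_normal_cone G x)).2.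

(* Such a delta exists for every disjunctive G and y in G; AI_at and AE_at only
   grow with delta, so a larger delta makes MPDC_RCPLD more demanding. *)
Definition normal_radius (R : realType) (q : nat) (G : set 'rV[R]_q)
    (y : 'rV[R]_q) (delta : R) : Prop :=
  0 < delta /\
  limiting_normal_cone G y =
    \bigcup_(x in ball y delta `&` G) regular_normal_cone G x.

Definition AI_at (R : realType) (gen : generator_choice R) (q : nat)
    (G : set 'rV[R]_q) (y : 'rV[R]_q) (delta : R) : set 'rV[R]_q :=
  \bigcup_(x in ball y delta `&` G)
    [set` (gen q (regular_normal_cone G x)).1].

Definition AE_at (R : realType) (gen : generator_choice R) (q : nat)
    (G : set 'rV[R]_q) (y : 'rV[R]_q) (delta : R) : set 'rV[R]_q :=
  \bigcup_(x in ball y delta `&` G)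
    [set` (gen q (regular_normal_cone G x)).2].

Definition feasible (R : realType) (d n m l : nat) (p : 'I_l -> nat)
    (g : 'rV[R]_d -> 'rV[R]_n) (h : 'rV[R]_d -> 'rV[R]_m)
    (Phi : forall i : 'I_l, 'rV[R]_d -> 'rV[R]_(p i))
    (Gamma : forall i : 'I_l, set 'rV[R]_(p i)) : set 'rV[R]_d :=
  [set x | [/\ forall i, g x 0 i <= 0, h x = 0
             & forall i, Gamma i (Phi i x)]].

Definition local_solution (R : realType) (d : nat) (f : 'rV[R]_d -> R)
    (F : set 'rV[R]_d) (xbar : 'rV[R]_d) : Prop :=
  F xbar /\ \forall x \near xbar, F x -> f xbar <= f x.

Definition active (R : realType) (d n : nat) (g : 'rV[R]_d -> 'rV[R]_n)
    (xbar : 'rV[R]_d) : {set 'I_n} :=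
  [set i | g xbar 0 i == 0].

(* The indexed family {v_i}_(i in I) u {nabla h_i(x)}_(i in J)
   u {nabla Phi_i(x)^T beta}_(i, beta in A^I_i u A^E_i), as a list. It is kept
   as a list, not a set, so that a repeated vector makes it dependent. *)
Definition RCPLD_family (R : realType) (d n m l : nat) (p : 'I_l -> nat)
    (h : 'rV[R]_d -> 'rV[R]_m)
    (Phi : forall i : 'I_l, 'rV[R]_d -> 'rV[R]_(p i))
    (I : {set 'I_n}) (J : {set 'I_m})
    (AI AE : forall i : 'I_l, {fset 'rV[R]_(p i)})
    (x : 'rV[R]_d) (v : 'I_n -> 'rV[R]_d) : seq 'rV[R]_d :=
  [seq v i | i <- enum I] ++ [seq gradient h x i | i <- enum J] ++
  flatten [seq [seq adjoint_jacobian (Phi i) x beta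
                  | beta <- enum_fset (AI i `|` AE i)%fset]
             | i <- enum 'I_l].

Definition MPDC_RCPLD (R : realType) (d n m l : nat) (p : 'I_l -> nat)
    (g : 'rV[R]_d -> 'rV[R]_n) (h : 'rV[R]_d -> 'rV[R]_m)
    (Phi : forall i : 'I_l, 'rV[R]_d -> 'rV[R]_(p i))
    (Gamma : forall i : 'I_l, set 'rV[R]_(p i))
    (gen : generator_choice R) (delta : 'I_l -> R) (xbar : 'rV[R]_d) : Prop :=
  (\forall x \near xbar,
     \dim <<[seq gradient h x i | i <- enum 'I_m]>>%VS =
     \dim <<[seq gradient h xbar i | i <- enum 'I_m]>>%VS)
  /\
  (forall J : {set 'I_m},
   basis_of <<[seq gradient h xbar i | i <- enum 'I_m]>>%VS
            [seq gradient h xbar i | i <- enum J] ->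
   forall (I : {set 'I_n}) (lamh : 'rV[R]_m) (lamg : 'rV[R]_n)
          (eta : forall i : 'I_l, 'rV[R]_(p i)) (v : 'I_n -> 'rV[R]_d),
   I \subset active g xbar ->
   ~ [/\ lamh = 0, lamg = 0 & forall i, eta i = 0] ->
   (forall i, i \notin J -> lamh 0 i = 0) ->
   (forall i, i \notin I -> lamg 0 i = 0) ->
   (forall i, 0 <= lamg 0 i) ->
   (forall i, i \in I ->
      limiting_subdifferential (fun x => g x 0 i) xbar (v i)) ->
   (forall i, limiting_normal_cone (Gamma i) (Phi i xbar) (eta i)) ->
   0 = \sum_(i in I) lamg 0 i *: v i
       + \sum_(i in J) lamh 0 i *: gradient h xbar i
       + \sum_(i < l) adjoint_jacobian (Phi i) xbar (eta i) ->
   forall (xk : nat -> 'rV[R]_d) (vk : nat -> 'I_n -> 'rV[R]_d)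
          (AI AE : forall i : 'I_l, {fset 'rV[R]_(p i)}),
   xk @ \oo --> xbar ->
   (forall k, xk k <> xbar) ->
   (forall k i, i \in I ->
      limiting_subdifferential (fun x => g x 0 i) (xk k) (vk k i)) ->
   (forall i, i \in I -> (fun k => vk k i) @ \oo --> v i) ->
   (forall i, [set` AI i] `<=` AI_at gen (Gamma i) (Phi i xbar) (delta i)) ->
   (forall i, [set` AE i] `<=` AE_at gen (Gamma i) (Phi i xbar) (delta i)) ->
   (forall i, eta i <> 0 ->
      [/\ free (enum_fset (AI i `|` AE i)%fset),
          cone_plus_span (AI i) (AE i) (eta i) &
          cone_plus_span (AI i) (AE i) `<=`
            limiting_normal_cone (Gamma i) (Phi i xbar)]) ->
   (forall i, eta i = 0 -> (AI i `|` AE i = fset0)%fset) ->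
   \forall k \near \oo, ~~ free (RCPLD_family h Phi I J AI AE (xk k) (vk k))).

Definition M_stationary (R : realType) (d n m l : nat) (p : 'I_l -> nat)
    (f : 'rV[R]_d -> R)
    (g : 'rV[R]_d -> 'rV[R]_n) (h : 'rV[R]_d -> 'rV[R]_m)
    (Phi : forall i : 'I_l, 'rV[R]_d -> 'rV[R]_(p i))
    (Gamma : forall i : 'I_l, set 'rV[R]_(p i)) (xbar : 'rV[R]_d) : Prop :=
  exists (lamg : 'rV[R]_n) (lamh : 'rV[R]_m)
         (eta : forall i : 'I_l, 'rV[R]_(p i)),
  [/\ exists (v0 : 'rV[R]_d) (v : 'I_n -> 'rV[R]_d),
        [/\ limiting_subdifferential f xbar v0,
            forall i, i \in active g xbar ->
              limiting_subdifferential (fun x => g x 0 i) xbar (v i) &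
            0 = v0 + \sum_(i in active g xbar) lamg 0 i *: v i
                + \sum_(i < m) lamh 0 i *: gradient h xbar i
                + \sum_(i < l) adjoint_jacobian (Phi i) xbar (eta i)],
      forall i, i \in active g xbar -> 0 <= lamg 0 i &
      forall i, limiting_normal_cone (Gamma i) (Phi i xbar) (eta i)].

(* Main.v *)
Require Import Defs.
From mathcomp Require Import all_boot all_order all_algebra finmap.
From mathcomp Require Import all_classical all_reals all_analysis.
From mathcomp Require Import ring lra.

(* Penalize: let [(x_k, z_k)], [z_k] in the product of the [Gamma_i], minimize
     f x + |x - xbar|^2 + k (|max(g x, 0)|^2 + |h x|^2 + sum_i |Phi_i x - z_i|^2)
   near [(xbar, Phi xbar)]; then [x_k --> xbar].  Optimality in [z_i] says that
   [2k (Phi_i x_k - z_{k,i})] is a regular normal to [Gamma_i] at [z_{k,i}];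
   optimality in [x] and the sum rule for limiting subgradients give, at [x_k],
   an M-stationarity system with residual [2 (x_k - xbar)].  If [x_k = xbar] all
   multipliers vanish and we are done.  Otherwise, [Gamma_i] has finitely many
   regular normal cones, so the cone at [z_{k,i}] may be taken constant, with a
   fixed generator.  Constant rank reduces the gradients of [h] to a basis, and a
   Caratheodory reduction makes the vectors carrying the multipliers independent.
   Divide the system by [1 + sum |multipliers|] and pass to the limit: either [f]
   keeps a positive weight, and the limit is M-stationarity, or the limit is a
   nonzero abnormal multiplier, and MPDC-RCPLD contradicts the independence.

   Instead of extracting subsequences, all limits are taken along one ultrafilter
   [U] on [nat] that refines [\oo]: along [U] bounded sequences converge and
   sequences with finitely many values are eventually constant. *)

Set Implicit Arguments.
Unset Strict Implicit.
Unset Printing Implicit Defensive.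

Import Order.TTheory GRing.Theory Num.Theory.
Import numFieldNormedType.Exports.

Local Open Scope classical_set_scope.
Local Open Scope ring_scope.

(** * Euclidean product and limits *)

(** MPDC-RCPLD contradicts independence only for a family that contains every gradient of [h]
    indexed by [J], whose generator sets span a subcone of the limiting normal cone, and whose index
    sets do not change with [k]. Hence Caratheodory may drop subgradients of [g] and generators, but
    never an index of [J]. The variables [z_k] are kept, rather than eliminated through a distance
    function, because they exhibit each multiplier as a regular normal at a nearby point: its cone
    recurs along [U], so it lies in the limiting normal cone at the limit point, and it supplies the
    generators. The reduction comes before the normalization: reducing a nonzero multiplier may
    cancel it altogether, whereas the normalized coefficients of the reduced family keep a nonzero
    limit whenever the weight of [f] tends to zero. *)

Section dot_product.
Context {R : realType}.

Lemma dotC d (u v : 'rV[R]_d) : dot u v = dot v u.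
Proof. by apply: eq_bigr => j _; rewrite mulrC. Qed.

Lemma dotDr d (u v w : 'rV[R]_d) : dot u (v + w) = dot u v + dot u w.
Proof. by rewrite -big_split; apply: eq_bigr => j _; rewrite mxE mulrDr. Qed.

Lemma dotZr d a (u v : 'rV[R]_d) : dot u (a *: v) = a * dot u v.
Proof. by rewrite /dot mulr_sumr; apply: eq_bigr => j _; rewrite mxE mulrCA. Qed.

Lemma dotNr d (u v : 'rV[R]_d) : dot u (- v) = - dot u v.
Proof. by rewrite -scaleN1r dotZr mulN1r. Qed.

Lemma dotBr d (u v w : 'rV[R]_d) : dot u (v - w) = dot u v - dot u w.
Proof. by rewrite dotDr dotNr. Qed.

Lemma dotDl d (u v w : 'rV[R]_d) : dot (v + w) u = dot v u + dot w u.
Proof. by rewrite dotC dotDr !(dotC u). Qed.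

Lemma dotZl d a (u v : 'rV[R]_d) : dot (a *: v) u = a * dot v u.
Proof. by rewrite dotC dotZr (dotC u). Qed.

Lemma dotNl d (u v : 'rV[R]_d) : dot (- v) u = - dot v u.
Proof. by rewrite dotC dotNr (dotC u). Qed.

Lemma dotBl d (u v w : 'rV[R]_d) : dot (v - w) u = dot v u - dot w u.
Proof. by rewrite dotDl dotNl. Qed.

Lemma dot0l d (u : 'rV[R]_d) : dot 0 u = 0.
Proof. by rewrite /dot big1 // => j _; rewrite mxE mul0r. Qed.

Lemma dot0r d (u : 'rV[R]_d) : dot u 0 = 0.
Proof. by rewrite dotC dot0l. Qed.

Lemma dot_suml d I (r : seq I) (P : pred I) (F : I -> 'rV[R]_d) u :
  dot (\sum_(i <- r | P i) F i) u = \sum_(i <- r | P i) dot (F i) u.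
Proof.
by elim/big_rec2: _ => [|i y x _ <-]; rewrite ?dot0l // dotDl.
Qed.

Lemma norm_coord d (v : 'rV[R]_d) j : `|v 0 j| <= `|v|.
Proof.
rewrite -[leRHS]/(mx_norm v) mx_normrE.
by apply: (le_bigmax _ (fun ij => `|v ij.1 ij.2|) (0, j)).
Qed.

Lemma norm_le_coord d (v : 'rV[R]_d) e :
  0 <= e -> (forall j, `|v 0 j| <= e) -> `|v| <= e.
Proof.
move=> e0 ve; rewrite -[leLHS]/(mx_norm v) mx_normrE.
by apply: bigmax_le => // -[i j] _ /=; rewrite ord1.
Qed.

Lemma dot_norm_le d (u v : 'rV[R]_d) : `|dot u v| <= d%:R * `|u| * `|v|.
Proof.
apply: (le_trans (ler_norm_sum _ _ _)).
rewrite -mulrA mulr_natl -[X in _ *+ X]card_ord -sumr_const.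
by apply: ler_sum => j _; rewrite normrM ler_pM ?norm_coord.
Qed.

Lemma dot_ge0 d (v : 'rV[R]_d) : 0 <= dot v v.
Proof. by apply: sumr_ge0 => j _; rewrite -expr2 sqr_ge0. Qed.

Lemma sqr_coord_le_dot d (v : 'rV[R]_d) j : v 0 j ^+ 2 <= dot v v.
Proof.
rewrite /dot (bigD1 j) //= expr2 lerDl.
by apply: sumr_ge0 => i _; rewrite -expr2 sqr_ge0.
Qed.

(** The norm of the space is the sup norm while the penalties are Euclidean; this bound and
    [dot_norm_le] are the two directions of the comparison. *)
Lemma sqr_norm_le_dot d (v : 'rV[R]_d) : `|v| ^+ 2 <= dot v v.
Proof.
rewrite -[leRHS]sqr_sqrtr ?dot_ge0 // ler_sqr ?nnegrE ?sqrtr_ge0 //.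
apply: norm_le_coord => [|j]; first exact: sqrtr_ge0.
by rewrite -sqrtr_sqr ler_sqrt ?dot_ge0 // sqr_coord_le_dot.
Qed.

Lemma dot_eq0 d (v : 'rV[R]_d) : dot v v = 0 -> v = 0.
Proof.
move=> v0; apply/eqP; rewrite -normr_le0 -(ler_pXn2r (n := 2)) ?nnegrE //.
by rewrite expr0n /= -[leRHS]v0 sqr_norm_le_dot.
Qed.

Lemma dot_adjoint_jacobian d q (F : 'rV[R]_d -> 'rV[R]_q) x eta u :
  dot (adjoint_jacobian F x eta) u = dot eta (u *m 'J F x).
Proof.
have dotE n (a b : 'rV[R]_n) : dot a b = (a *m b^T) 0 0.
  by rewrite mxE; apply: eq_bigr => j _; rewrite mxE.
by rewrite !dotE /adjoint_jacobian trmx_mul mulmxA.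
Qed.

Lemma adjoint_jacobianZ d q (F : 'rV[R]_d -> 'rV[R]_q) x a eta :
  adjoint_jacobian F x (a *: eta) = a *: adjoint_jacobian F x eta.
Proof. by rewrite /adjoint_jacobian -scalemxAl. Qed.

Lemma adjoint_jacobian_sum d q (F : 'rV[R]_d -> 'rV[R]_q) x
    I (r : seq I) (P : pred I) (eta : I -> 'rV[R]_q) :
  adjoint_jacobian F x (\sum_(i <- r | P i) eta i) =
  \sum_(i <- r | P i) adjoint_jacobian F x (eta i).
Proof. by rewrite /adjoint_jacobian mulmx_suml. Qed.

Lemma sum_gradient d q (F : 'rV[R]_d -> 'rV[R]_q) x (mu : 'rV[R]_q) :
  \sum_(i < q) mu 0 i *: gradient F x i = adjoint_jacobian F x mu.
Proof.
apply/rowP => j; rewrite summxE mxE; apply: eq_bigr => i _.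
by rewrite !mxE.
Qed.

End dot_product.

Section row_limits.
Context {R : realType}.

Lemma cvg_sum T (F : set_system T) {FF : Filter F} (V : normedModType R)
    I (r : seq I) (P : pred I) (u : I -> T -> V) (a : I -> V) :
  (forall i, P i -> u i @ F --> a i) ->
  (fun k => \sum_(i <- r | P i) u i k) @ F --> \sum_(i <- r | P i) a i.
Proof. by move=> ua; apply: cvg_big => //; exact: add_continuous. Qed.

Lemma cvg_rowP T (F : set_system T) {FF : Filter F} d (u : T -> 'rV[R]_d)
    (a : 'rV[R]_d) :
  (forall j, (fun k => u k 0 j) @ F --> a 0 j) -> u @ F --> a.
Proof.
move=> ua; apply/cvgrPdist_le => e e0.
have : \forall k \near F, forall j, `|a 0 j - u k 0 j| <= e.
  apply: filter_forall => j.
  by have /cvgrPdist_le /(_ e e0) := ua j.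
apply: filterS => k ke; apply: norm_le_coord => [|j]; first exact: ltW.
by have := ke j; rewrite !mxE.
Qed.

Lemma cvg_coord T (F : set_system T) {FF : Filter F} d (u : T -> 'rV[R]_d)
    (a : 'rV[R]_d) j :
  u @ F --> a -> (fun k => u k 0 j) @ F --> a 0 j.
Proof.
move=> ua; apply: (@cvg_comp _ _ _ u (fun v : 'rV[R]_d => v 0 j)) (ua) _.
exact: coord_continuous.
Qed.

Lemma cvg_dot T (F : set_system T) {FF : Filter F} d (u v : T -> 'rV[R]_d)
    (a b : 'rV[R]_d) :
  u @ F --> a -> v @ F --> b -> (fun k => dot (u k) (v k)) @ F --> dot a b.
Proof.
by move=> ua vb; apply: cvg_sum => j _; apply: cvgM; exact: cvg_coord.
Qed.

Lemma cvg_dist_le T (F : set_system T) {FF : ProperFilter F} d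
    (u : T -> 'rV[R]_d) (a x : 'rV[R]_d) (r : R) :
  (forall k, `|u k - x| <= r) -> u @ F --> a -> `|a - x| <= r.
Proof.
move=> ur ua; have un : (fun k => `|u k - x|) @ F --> `|a - x|.
  by apply: cvg_norm; apply: cvgB => //; exact: cvg_cst.
by apply: (cvgr_to_le un); exact: filterE.
Qed.

Lemma near_norm_le T (F : set_system T) {FF : Filter F} d
    (u : T -> 'rV[R]_d) (x : 'rV[R]_d) (r : R) :
  (forall k, `|u k - x| <= r) -> \forall k \near F, `|u k| <= `|x| + r.
Proof.
move=> ur; apply: filterE => k; rewrite -(subrK x (u k)) addrC.
by rewrite (le_trans (ler_normD _ _)) // lerD.
Qed.

Lemma cvg_mulmx_tr T (F : set_system T) {FF : Filter F} d q
    (A : T -> 'M[R]_(d, q)) (B : 'M[R]_(d, q)) (eta : 'rV[R]_q) :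
  A @ F --> B -> (fun k => eta *m (A k)^T) @ F --> eta *m B^T.
Proof.
move=> AB; apply: cvg_rowP => j.
have entry (M : 'M[R]_(d, q)) : (eta *m M^T) 0 j = \sum_i eta 0 i * M j i.
  by rewrite mxE; apply: eq_bigr => i _; rewrite mxE.
rewrite entry; under eq_fun do rewrite entry.
apply: cvg_sum => i _; apply: cvgM; first exact: cvg_cst.
exact: (@cvg_comp _ _ _ A (fun M : 'M[R]_(d, q) => M j i) _ _ _ AB
  (@coord_continuous _ _ _ _ _ _)).
Qed.

Lemma cvg_adjoint_jacobian T (F : set_system T) {FF : Filter F} d q
    (G : 'rV[R]_d -> 'rV[R]_q) (u : T -> 'rV[R]_d) (a : 'rV[R]_d) eta :
  continuously_differentiable G -> u @ F --> a ->
  (fun k => adjoint_jacobian G (u k) eta) @ F --> adjoint_jacobian G a eta.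
Proof.
move=> [_ cG] ua.
apply: (@cvg_mulmx_tr _ _ _ _ _ (jacobian G \o u) (jacobian G a)).
exact: (@cvg_comp _ _ _ u (jacobian G) _ _ _ ua (cG a)).
Qed.

End row_limits.

(** Turns approximations of accuracy [1 / (k + 1)] into limits, along [\oo] for the definitions and
    along the ultrafilter in compactness arguments. *)
Lemma cvg_natSinv (R : realType) (F : set_system nat) {FF : Filter F}
    (V : normedModType R) (u : nat -> V) (a : V) :
  \oo `<=` F -> (forall k, `|u k - a| <= k.+1%:R^-1) -> u @ F --> a.
Proof.
move=> ooF ua; apply/cvgrPdist_le => e e0; apply: ooF; near=> k.
rewrite distrC (le_trans (ua k)) // ltW //; near: k.
exact: near_infty_natSinv_lt (PosNum e0).
Unshelve. all: by end_near. Qed.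

Lemma near_and T (F : set_system T) {FF : Filter F} (P Q : T -> Prop) :
  (\forall k \near F, P k) -> (\forall k \near F, Q k) ->
  \forall k \near F, P k /\ Q k.
Proof. exact: filterI. Qed.

Lemma near_ex2 T (F : set_system T) {FF : ProperFilter F} (P Q : T -> Prop) :
  (\forall k \near F, P k) -> (\forall k \near F, Q k) ->
  exists k, P k /\ Q k.
Proof. by move=> FP FQ; have [k [Pk Qk]] := filter_ex (filterI FP FQ); exists k. Qed.

Lemma near_ex3 T (F : set_system T) {FF : ProperFilter F} (P Q S : T -> Prop) :
  (\forall k \near F, P k) -> (\forall k \near F, Q k) ->
  (\forall k \near F, S k) -> exists k, [/\ P k, Q k & S k].
Proof.
move=> FP FQ FS; have [k [Pk [Qk Sk]]] := near_ex2 FP (filterI FQ FS).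
by exists k.
Qed.

(** * Limits along an ultrafilter *)

Section ultrafilters.
Context {T : Type} (U : set_system T) {UU : UltraFilter U}.

Lemma ultra_dichotomy (P : T -> Prop) :
  (\forall k \near U, P k) \/ (\forall k \near U, ~ P k).
Proof. exact: (@in_ultra_setVsetC _ U P UU). Qed.

#[export] Instance ultra_fmap V (u : T -> V) : UltraFilter (u @ U).
Proof.
split=> [|G GG uG]; first exact: fmap_proper_filter.
apply/seteqP; split=> // A GA.
have [//|nA] := ultra_dichotomy (fun k => A (u k)).
have /uG GnA : (u @ U) (~` A) by [].
by have /filter_ex [? []] : G (A `&` ~` A) by exact: filterI.
Qed.

Lemma ultra_compact_cvg (V : topologicalType) (A : set V) (u : T -> V) :
  compact A -> (\forall k \near U, A (u k)) ->
  exists2 a, A a & u @ U --> a.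
Proof.
rewrite compact_ultra => /(_ (u @ U) _) + Au => /(_ Au) [a []].
by exists a.
Qed.

(** Takes the place of the pigeonhole choice of a subsequence: if each value were avoided along [U],
    a finite intersection would avoid all of them at once. *)
Lemma ultra_constant (X : finType) (F : T -> X) :
  exists x, \forall k \near U, F k = x.
Proof.
apply: contrapT => /forallNP nF.
have : \forall k \near U, forall x, F k <> x.
  by apply: filter_forall => x; have [/nF|] := ultra_dichotomy (fun k => F k = x).
by move/filter_ex => [k /(_ (F k))].
Qed.

Lemma ultra_bounded_cvg (R : realType) d (u : T -> 'rV[R]_d) M :
  (\forall k \near U, `|u k| <= M) ->
  exists2 a, `|a| <= M & u @ U --> a.
Proof.
move=> uM; apply: (@ultra_compact_cvg _ [set v : 'rV[R]_d | `|v| <= M]) => //.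
apply: bounded_closed_compact.
  exists M; split; first exact: num_real.
  by move=> N MN v /= vM; rewrite (le_trans vM) ?ltW.
move=> v clv /=; apply/ler_addgt0Pr => e e0.
have [w [/= wM]] := clv _ (nbhsx_ballx v e e0).
rewrite -ball_normE /= => /ltW vw.
by rewrite -(subrK w v) (le_trans (ler_normD _ _)) // addrC lerD.
Qed.

Lemma ultra_bounded_cvgR (R : realType) (u : T -> R) M :
  (\forall k \near U, `|u k| <= M) -> exists2 a, `|a| <= M & u @ U --> a.
Proof.
move=> uM; have [||a] := @ultra_compact_cvg _ `[- M, M]%classic u.
- exact: segment_compact.
- by apply: filterS uM => k; rewrite /= in_itv /= ler_norml.
- by rewrite /= in_itv /= -ler_norml; exists a.
Qed.

End ultrafilters.

(** [X] carries no topology: it will be a vector paired with a family of vectors, and the direct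
    method only uses that the values along any sequence in [A] converge to the value at some point
    of [A]. *)
Lemma minimum_from_limits (R : realType) (U : set_system nat) {UU : UltraFilter U}
    (X : Type) (A : set X) (F : X -> R) :
  \oo `<=` U -> A !=set0 ->
  (forall u : nat -> X, (forall k, A (u k)) ->
     exists2 a, A a & (F \o u) @ U --> F a) ->
  exists2 a, A a & forall x, A x -> F a <= F x.
Proof.
move=> ooU [x0 Ax0] lim.
(* Used twice: with [b] tending to the infimum, and with [b k = - k], where the limit value would
   lie below every constant. *)
have key (b : nat -> R) : (forall k, exists x, A x /\ F x <= b k) ->
    exists2 a, A a & forall c, (\forall k \near \oo, b k <= c) -> F a <= c.
  move=> /choice [u /all_and2 [Au Fu]].
  have [a Aa aF] := lim u Au; exists a => // c bc.
  apply: (cvgr_to_le aF).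
  by apply: filterS (ooU _ bc) => k; apply: le_trans (Fu k).
have [lbF|nlb] := pselect (has_lbound (F @` A)).
  have infF : has_inf (F @` A) by split=> //; exists (F x0), x0.
  have [k|a Aa aP] := key (fun k => inf (F @` A) + k.+1%:R^-1).
    have /(inf_adherent)/(_ infF) [_ [x Ax <-] Fx] : (0 : R) < k.+1%:R^-1.
      by rewrite invr_gt0.
    by exists x; split=> //; exact: ltW.
  exists a => // x Ax; have aI : F a <= inf (F @` A).
    apply/ler_addgt0Pr => e e0; apply: aP.
    near=> k; rewrite lerD2l ltW //; near: k.
    exact: near_infty_natSinv_lt (PosNum e0).
  by apply: (le_trans aI); apply: ge_inf => //; exists x.
have [k|a Aa aP] := key (fun k => - k%:R).
  apply: contrapT => /forallNP nx; apply: nlb; exists (- k%:R) => _ [x Ax <-].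
  by rewrite leNgt; apply/negP => /ltW Fx; exact: (nx x).
have : F a <= F a - 1.
  apply: aP; near=> k.
  have : 1 - F a <= k%:R by near: k; exact: nbhs_infty_ger.
  by lra.
by lra.
Unshelve. all: by end_near. Qed.

(** * Subdifferentials *)

Section subdifferentials.
Context {R : realType}.

Lemma near_distP (V : normedModType R) (x : V) (P : V -> Prop) :
  (\forall y \near x, P y) <->
  exists2 e : R, 0 < e & forall y, `|y - x| <= e -> P y.
Proof.
split=> [/nbhs_normP [e /= e0 eP]|[e e0 eP]].
  exists (e / 2); first by rewrite divr_gt0.
  move=> y ye; apply: eP; rewrite /ball_ /= distrC.
  by apply: le_lt_trans ye _; rewrite ltr_pdivrMr // ltr_pMr // ltr1n.
by apply/nbhs_normP; exists e => // y; rewrite /ball_ /= distrC => /ltW; exact: eP.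
Qed.

Lemma near_dist_le (V : normedModType R) (x c : V) (r : R) :
  `|x - c| < r -> \forall y \near x, `|y - c| <= r.
Proof.
move=> xr; apply/near_distP; exists (r - `|x - c|); first by rewrite subr_gt0.
by move=> y yx; have := ler_distD x y c; lra.
Qed.

Lemma lipschitz_nearP d (W : normedModType R) (f : 'rV[R]_d -> W) x :
  lipschitz_near f x -> exists L r : R, [/\ 0 < L, 0 < r &
    forall y z, `|y - x| <= r -> `|z - x| <= r -> `|f y - f z| <= L * `|y - z|].
Proof.
move=> [V /near_distP [r r0 rV] lipf].
have [M [_ Mlip]] := lipf.
exists (`|M| + 1), r; split=> // y z yr zr.
by apply: (Mlip (`|M| + 1) _ (y, z)); [rewrite ltr_pwDr // ler_norm | split; exact: rV].
Qed.

Lemma lipschitz_near_continuous d (W : normedModType R) (f : 'rV[R]_d -> W) x :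
  lipschitz_near f x -> {for x, continuous f}.
Proof.
move=> /lipschitz_nearP [L [r [L0 r0 Lf]]].
have near_x (e : R) : 0 < e -> \forall y \near x, `|f x - f y| <= e.
  move=> e0; apply/near_distP.
  exists (Num.min r (e / L)); first by rewrite lt_min r0 divr_gt0.
  move=> y; rewrite le_min => /andP[yr ye].
  rewrite (le_trans (Lf _ _ _ yr)) ?subrr ?normr0 ?(ltW r0) //.
  by rewrite mulrC -ler_pdivlMr // distrC.
apply/(@cvgrPdist_le _ _ _ _ (nbhs_filter x)) => e e0.
exact: near_x.
Qed.

Lemma frechet_subdifferentialP d (f : 'rV[R]_d -> R) (x v : 'rV[R]_d) :
  frechet_subdifferential f x v <->
  forall e : R, 0 < e -> exists2 r : R, 0 < r &
    forall y, `|y - x| <= r -> f x + dot v (y - x) - e * `|y - x| <= f y.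
Proof. by split=> vf e /vf; [move=> /near_distP|move=> ?; apply/near_distP]. Qed.

(** It is the sup norm of [v] that is bounded, so one direction per coordinate suffices: [r] times
    the basis vector, with the sign of [v 0 j]. *)
Lemma norm_le_dot d (v : 'rV[R]_d) (L r : R) : 0 <= L ->
  0 < r -> (forall h, `|h| <= r -> dot v h <= L * `|h|) -> `|v| <= L.
Proof.
move=> L0 r0 vL; apply: norm_le_coord => // j.
pose s : R := if 0 <= v 0 j then 1 else -1.
have s1 : `|s| = 1 by rewrite /s; case: ifP; rewrite ?normrN normr1.
have sv : s * v 0 j = `|v 0 j|.
  rewrite /s; case: ifPn => [v0|]; first by rewrite mul1r ger0_norm.
  by rewrite -ltNge => v0; rewrite mulN1r ltr0_norm.
have dE : dot v ((r * s) *: delta_mx 0 j) = r * `|v 0 j|.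
  rewrite dotZr -mulrA -sv; congr (_ * (_ * _)).
  rewrite /dot (bigD1 j) //= big1 => [|i ij]; rewrite !mxE ?eqxx ?mulr1 ?addr0 //.
  by rewrite (negbTE ij) andbF mulr0.
have hr : `|(r * s) *: (delta_mx 0 j : 'rV[R]_d)| <= r.
  apply: norm_le_coord => [|i]; first exact: ltW.
  rewrite !mxE normrM normrM s1 mulr1 gtr0_norm // ger_pMr //.
  by case: (_ && _); rewrite ?normr1 ?normr0.
have := vL _ hr; rewrite dE => /le_trans /(_ (ler_wpM2l L0 hr)).
by rewrite mulrC ler_pM2r.
Qed.

Lemma frechet_subdifferential_bound d (f : 'rV[R]_d -> R) (x v : 'rV[R]_d) (L : R) :
  0 <= L -> (\forall y \near x, `|f y - f x| <= L * `|y - x|) ->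
  frechet_subdifferential f x v -> `|v| <= L.
Proof.
move=> L0 Lf vf; apply/ler_addgt0Pr => e e0.
have [r r0 rP] := (near_distP _ _).1 (filterI Lf (vf e e0)).
apply: (norm_le_dot _ r0) => [|h hr]; first by rewrite addr_ge0 // ltW.
have := rP (x + h); rewrite [x + h]addrC addrK => /(_ hr) [/=].
rewrite !addrK => /(le_trans (ler_norm _)) H1 H2; rewrite mulrDl; lra.
Qed.

(** A form without sequences, into which a second approximation can be inserted: closedness and
    bounds become triangle inequalities. *)
Lemma limiting_subdifferentialP d (f : 'rV[R]_d -> R) (x v : 'rV[R]_d) :
  limiting_subdifferential f x v <->
  forall e : R, 0 < e -> exists y u, [/\ `|y - x| <= e, `|f y - f x| <= e,
    `|u - v| <= e & frechet_subdifferential f y u].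
Proof.
split=> [[xk [vk [/cvgrPdist_le xkx /cvgrPdist_le fx /cvgrPdist_le vkv vkf]]] e e0|H].
  have [k [ka kb kc]] := near_ex3 (xkx e e0) (fx e e0) (vkv e e0).
  by exists (xk k), (vk k); split; rewrite // distrC.
have H' k : exists yu : 'rV[R]_d * 'rV[R]_d, [/\ `|yu.1 - x| <= k.+1%:R^-1,
    `|f yu.1 - f x| <= k.+1%:R^-1, `|yu.2 - v| <= k.+1%:R^-1 &
    frechet_subdifferential f yu.1 yu.2].
  have [|y [u yu]] := H k.+1%:R^-1; first by rewrite invr_gt0.
  by exists (y, u).
have [yu yuP] := choice H'.
exists (fun k => (yu k).1), (fun k => (yu k).2); split.
- by apply: cvg_natSinv => // k; have [] := yuP k.
- by apply: cvg_natSinv => // k; have [] := yuP k.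
- by apply: cvg_natSinv => // k; have [] := yuP k.
- by move=> k; have [] := yuP k.
Qed.

Lemma frechet_sub_limiting d (f : 'rV[R]_d -> R) x :
  frechet_subdifferential f x `<=` limiting_subdifferential f x.
Proof.
move=> v vf; apply/limiting_subdifferentialP => e e0.
by exists x, v; rewrite !subrr !normr0 ltW.
Qed.

Lemma limiting_subdifferential_closed T (F : set_system T) {FF : ProperFilter F}
    d (f : 'rV[R]_d -> R) (xk vk : T -> 'rV[R]_d) (x v : 'rV[R]_d) :
  {for x, continuous f} -> xk @ F --> x -> vk @ F --> v ->
  (\forall k \near F, limiting_subdifferential f (xk k) (vk k)) ->
  limiting_subdifferential f x v.
Proof.
move=> /cvgrPdist_le cf /cvgrPdist_le xkx /cvgrPdist_le vkv vkf.
apply/limiting_subdifferentialP => e e0.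
have [r r0 rP] := (near_distP _ _).1 (cf e e0).
(* Halves, because two moves of size [m] lead from the limit pair through [(xk k, vk k)] to the
   Frechet pair. *)
pose m := Num.min (e / 2) (r / 2).
have m0 : 0 < m by rewrite lt_min !divr_gt0.
have [k [kx kv kf]] := near_ex3 (xkx m m0) (vkv m m0) vkf.
have [y [u [yk _ uk uf]]] := (limiting_subdifferentialP _ _ _).1 kf m m0.
have me : m <= e / 2 by rewrite ge_min lexx.
have mr : m <= r / 2 by rewrite ge_min lexx orbT.
have yx : `|y - x| <= m + m.
  by rewrite (le_trans (ler_distD (xk k) _ _)) // lerD // distrC.
exists y, u; split=> //; [lra | rewrite distrC; apply: rP; lra |].
by rewrite (le_trans (ler_distD (vk k) _ _)) // (distrC (vk k)); lra.
Qed.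

Lemma limiting_subdifferential_bound d (f : 'rV[R]_d -> R) (x0 x v : 'rV[R]_d)
    (L r : R) :
  0 <= L ->
  (forall y z, `|y - x0| <= r -> `|z - x0| <= r -> `|f y - f z| <= L * `|y - z|) ->
  `|x - x0| < r -> limiting_subdifferential f x v -> `|v| <= L.
Proof.
move=> L0 Lf xr /limiting_subdifferentialP vf; apply/ler_addgt0Pr => e e0.
(* Half of the room left in the ball goes to reaching [y], the other half to a neighbourhood of [y]
   on which the Lipschitz bound still applies. *)
pose m := Num.min e ((r - `|x - x0|) / 2).
have m0 : 0 < m by rewrite lt_min e0 divr_gt0 // subr_gt0.
have [y [u [yx _ uv uf]]] := vf m m0.
have me : m <= e by rewrite ge_min lexx.
have mr : m <= (r - `|x - x0|) / 2 by rewrite ge_min lexx orbT.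
have uL : `|u| <= L.
  apply: (frechet_subdifferential_bound L0 _ uf).
  apply/near_distP; exists m => // z zy.
  have yx0 := ler_distD x y x0; have zx0 := ler_distD y z x0.
  by apply: Lf; lra.
have : `|v| <= `|v - u| + `|u| by rewrite -[X in `|X| <= _](subrK u) ler_normD.
by rewrite (distrC v); lra.
Qed.

(** For [a = 0] the scaled function is constant, which forces [v = 0]; any subgradient of [f] is
    then a witness, hence the nonemptiness assumption. This case arises for each constraint that is
    not violated. *)
Lemma limiting_subdifferential_scale d (f : 'rV[R]_d -> R) (x v : 'rV[R]_d) (a : R) :
  0 <= a -> limiting_subdifferential f x !=set0 ->
  limiting_subdifferential (fun y => a * f y) x v ->
  exists2 u, limiting_subdifferential f x u & v = a *: u.
Proof.
rewrite le_eqVlt => /orP[/eqP <- [u uf] vf|a0 _ vf].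
  exists u => //; rewrite scale0r; apply/eqP; rewrite -normr_le0.
  apply: (@limiting_subdifferential_bound _ _ x x _ 0 1) vf => //; last first.
    by rewrite subrr normr0.
  by move=> y z _ _; rewrite !mul0r subrr normr0.
exists (a^-1 *: v); last by rewrite scalerA divff ?scale1r // gt_eqF.
move/limiting_subdifferentialP : vf => vf.
apply/limiting_subdifferentialP => e e0.
pose m := Num.min e (a * e).
have m0 : 0 < m by rewrite lt_min e0 mulr_gt0.
have me : m <= e by rewrite ge_min lexx.
have mr : m <= a * e by rewrite ge_min lexx orbT.
have [y [u [yx fyx uv uf]]] := vf m m0.
exists y, (a^-1 *: u); split.
- exact: le_trans me.
- move: fyx; rewrite -mulrBr normrM gtr0_norm // => /le_trans /(_ mr).
  by rewrite ler_pM2l.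
- rewrite -scalerBr normrZ gtr0_norm ?invr_gt0 // ler_pdivrMl //.
  exact: le_trans uv mr.
apply/frechet_subdifferentialP => e1 e10.
have [|r r0 rP] := (frechet_subdifferentialP _ _ _).1 uf (a * e1).
  by rewrite mulr_gt0.
exists r => // z /rP; rewrite dotZl => H.
rewrite -(ler_pM2l a0) mulrBr mulrDr [a * (a^-1 * _)]mulrA divff ?gt_eqF // mul1r.
by rewrite [a * (e1 * _)]mulrA.
Qed.

End subdifferentials.

(** * Penalization and the sum rule *)

Section penalty.
Context {R : realType}.

Lemma ultra_family_cvg T (U : set_system T) {UU : UltraFilter U} (I : Type)
    (p : I -> nat) (z : T -> forall i, 'rV[R]_(p i)) (M : I -> R) :
  (forall i, \forall k \near U, `|z k i| <= M i) ->
  exists a : forall i, 'rV[R]_(p i), forall i, (fun k => z k i) @ U --> a i.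
Proof.
move=> zM; pose H (i : I) := cid2 (@ultra_bounded_cvg _ U UU _ _ _ _ (zM i)).
by exists (fun i => s2val (H i)) => i; case: (H i).
Qed.

(** The penalty method in the abstract: comparison with [x0] bounds [k * p (u k)] by
    [b x0 - b (u k)], so the limit has zero penalty. [conv] will be componentwise convergence, both
    for the decoupled sum rule and for the constrained problem. *)
Lemma penalty_minimizers (U : set_system nat) {UU : UltraFilter U} (X : Type)
    (A : set X) (conv : (nat -> X) -> X -> Prop) (b p : X -> R) (x0 : X) :
  \oo `<=` U -> A x0 -> p x0 = 0 -> (forall x, A x -> 0 <= p x) ->
  (forall u, (forall k, A (u k)) -> exists2 a, A a & conv u a) ->
  (forall u a, (forall k, A (u k)) -> A a -> conv u a -> (b \o u) @ U --> b a) ->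
  (forall u a, (forall k, A (u k)) -> A a -> conv u a -> (p \o u) @ U --> p a) ->
  exists (u : nat -> X) (a : X), [/\ forall k, A (u k) /\
      forall x, A x -> b (u k) + k%:R * p (u k) <= b x + k%:R * p x,
    A a, conv u a, p a = 0 & b a <= b x0].
Proof.
move=> ooU Ax0 px0 p0 cpt cb cp.
have /choice [u uP] (k : nat) : exists x, A x /\
    forall y, A y -> b x + k%:R * p x <= b y + k%:R * p y.
  have [||a Aa aP] := @minimum_from_limits R U UU X A (fun x => b x + k%:R * p x) ooU.
  - by exists x0.
  - move=> u Au; have [a Aa ua] := cpt u Au; exists a => //.
    apply: cvgD; first exact: cb ua.
    by apply: cvgM; [exact: cvg_cst | exact: cp ua].
  - by exists a.
have Au k : A (u k) by have [] := uP k.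
have [a Aa ua] := cpt u Au.
exists u, a; have bu := cb _ _ Au Aa ua; have pu := cp _ _ Au Aa ua.
have le_b k : b (u k) + k%:R * p (u k) <= b x0.
  by have [_ /(_ x0 Ax0)] := uP k; rewrite px0 mulr0 addr0.
split=> //; last first.
  apply: (cvgr_to_le bu); near=> k.
  by apply: le_trans (le_b k); rewrite lerDl mulr_ge0 ?p0.
apply/eqP; rewrite eq_le p0 // andbT; apply/ler_addgt0Pr => e e0; rewrite add0r.
apply: (cvgr_to_le pu).
have bnear : \forall k \near U, b a - 1 <= b (u k).
  by apply: (cvgr_ge _ bu); rewrite ltrBlDr ltrDl.
(* Beyond this [k] a penalty above [e] would cost more than [b x0 - b a + 1]; the [1] pays for
   [b (u k)] being only close to [b a], and the maximum keeps [k] positive. *)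
have knear : \forall k \near U, Num.max 1 ((b x0 - b a + 1) / e) <= k%:R.
  by apply: ooU; exact: nbhs_infty_ger.
apply: filterS2 bnear knear => k bk; rewrite ge_max => /andP[k1].
rewrite ler_pdivrMr // => ke.
have k0 : (0 : R) < k%:R by rewrite (lt_le_trans _ k1).
rewrite -(ler_pM2l k0) /=; have := le_b k; lra.
Unshelve. all: by end_near. Qed.

Lemma dot_sqrD d (a h : 'rV[R]_d) :
  dot (a + h) (a + h) = dot a a + 2 * dot a h + dot h h.
Proof. by rewrite dotDl !dotDr (dotC h a); ring. Qed.

Lemma dot_sqrB d (a h : 'rV[R]_d) :
  dot (a - h) (a - h) = dot a a - 2 * dot a h + dot h h.
Proof. by rewrite dotBl !dotBr (dotC h a); ring. Qed.

Lemma quadratic_small d (C e : R) : 0 <= C -> 0 < e ->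
  exists2 r : R, 0 < r & forall h : 'rV[R]_d, `|h| <= r -> C * dot h h <= e * `|h|.
Proof.
move=> C0 e0; pose r := e / (C * d%:R + 1).
have D0 : 0 < C * d%:R + 1 by rewrite ltr_wpDl // mulr_ge0.
exists r; first by rewrite divr_gt0.
move=> h; rewrite /r ler_pdivlMr // => hr.
apply: (@le_trans _ _ (C * (d%:R * `|h| * `|h|))).
  by rewrite ler_wpM2l // (le_trans (ler_norm _)) // dot_norm_le.
rewrite !mulrA ler_wpM2r //.
by apply: le_trans hr; rewrite mulrC ler_wpM2l // lerDl.
Qed.

Lemma frechet_of_quadratic d (f : 'rV[R]_d -> R) (x v : 'rV[R]_d) (C : R) :
  0 <= C -> (\forall y \near x,
    f x + dot v (y - x) - C * dot (y - x) (y - x) <= f y) ->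
  frechet_subdifferential f x v.
Proof.
move=> C0 fv e e0; have [r r0 rP] := @quadratic_small d C e C0 e0.
have rnear : \forall y \near x, C * dot (y - x) (y - x) <= e * `|y - x|.
  by apply/near_distP; exists r => // y; exact: rP.
apply: filterS2 fv rnear => y; lra.
Qed.

End penalty.

Section sum_rule.
Context {R : realType}.
Context (I : finType) (d : nat) (phi : I -> 'rV[R]_d -> R) (x0 v : 'rV[R]_d).

Lemma sum_update (W : Type) (F : I -> W -> R) (y : I -> W) (i : I) (w : W) :
  \sum_j F j (if j == i then w else y j) =
  \sum_j F j (y j) - F i (y i) + F i w.
Proof.
rewrite (bigD1 i) //= eqxx [in RHS](bigD1 i) //= addrC; congr (_ + _).
rewrite [F i (y i) + _]addrC addrK; apply: eq_bigr => j /negbTE ->.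
by [].
Qed.

(* Decoupling: each [phi i] gets its own variable [y i], tied to a common [x]
   by a quadratic penalty. *)
Lemma fuzzy_sum_rule (L r0 e : R) : 0 <= L -> 0 < r0 -> 0 < e ->
  (forall i y z, `|y - x0| <= r0 -> `|z - x0| <= r0 ->
     `|phi i y - phi i z| <= L * `|y - z|) ->
  frechet_subdifferential (fun x => \sum_i phi i x) x0 v ->
  exists y u : I -> 'rV[R]_d,
    [/\ forall i, `|y i - x0| < r0, forall i, `|y i - x0| <= e,
        forall i, frechet_subdifferential (phi i) (y i) (u i) &
        `|\sum_i u i - v| <= e].
Proof.
move=> L0 r00 e0 Lphi vphi.
have [r1 r10 r1P] := (frechet_subdifferentialP _ _ _).1 vphi (e / 2)
  (divr_gt0 e0 (ltr0Sn _ 1)).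
pose rho := Num.min r1 (Num.min r0 e).
have rho0 : 0 < rho by rewrite !lt_min r10 r00 e0.
have rho1 : rho <= r1 by rewrite ge_min lexx.
have rho2 : rho <= r0 by rewrite !ge_min lexx ?orbT.
have rho3 : rho <= e by rewrite !ge_min lexx ?orbT.
have [U [UU ooU]] := @ultraFilterLemma nat \oo _.
pose X := ('rV[R]_d * (I -> 'rV[R]_d))%type.
pose A : set X := [set w | `|w.1 - x0| <= rho /\ forall i, `|w.2 i - x0| <= rho].
pose conv (u : nat -> X) (a : X) := (fun k => (u k).1) @ U --> a.1 /\
  forall i, (fun k => (u k).2 i) @ U --> a.2 i.
(* The subgradient inequality holds with slack [e / 2], so this tilt of slope [e] makes [x0] the
   strict minimizer of [b] among the points of [A] where all [y i] equal [x]. *)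
pose b (w : X) := \sum_i phi i (w.2 i) + (e * `|w.1 - x0| - dot v (w.1 - x0)).
pose p (w : X) := \sum_i dot (w.1 - w.2 i) (w.1 - w.2 i).
have p_ge0 w : 0 <= p w by apply: sumr_ge0 => i _; exact: dot_ge0.
have [|||u|||u [a [uP Aa [ua1 ua2] pa ba]]] :=
  @penalty_minimizers R U UU X A conv b p (x0, fun=> x0) ooU.
- by split=> /= [|i]; rewrite subrr normr0 ltW.
- by rewrite /p big1 // => i _; rewrite subrr dot0l.
- by [].
- move=> Au.
  have [a1 _ ua1] := ultra_bounded_cvg (near_norm_le (F := U) (fun k => (Au k).1)).
  have [a2 ua2] := @ultra_family_cvg _ _ U _ I (fun=> d) (fun k => (u k).2)
    (fun=> `|x0| + rho) (fun i => near_norm_le (F := U) (fun k => (Au k).2 i)).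
  exists (a1, a2) => //; split=> /= [|i].
    by apply: cvg_dist_le ua1 => k; have [] := Au k.
  by apply: cvg_dist_le (ua2 i) => k; have [_] := Au k.
- move=> u a Au Aa [ua1 ua2]; rewrite /b; apply: cvgD.
    apply: cvg_sum => i _; apply/cvgrPdist_le => e1 e10.
    have /cvgrPdist_le /(_ (e1 / (L + 1))) := ua2 i.
    have L1 : 0 < L + 1 by rewrite ltr_wpDl.
    rewrite divr_gt0 // => /(_ isT); apply: filterS => k.
    rewrite ler_pdivlMr // => uk.
    apply: (le_trans (Lphi i _ _ _ _)).
    + by apply: le_trans rho2; have [_] := Aa.
    + by apply: le_trans rho2; have [_] := Au k.
    + apply: le_trans uk; rewrite mulrC ler_wpM2l //.
      by rewrite lerDl.
  have ub : (fun k => (u k).1 - x0) @ U --> a.1 - x0.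
    by apply: cvgB => //; exact: cvg_cst.
  apply: cvgB; last by apply: cvg_dot => //; exact: cvg_cst.
  by apply: cvgM; [exact: cvg_cst | exact: cvg_norm].
- move=> u a Au Aa [ua1 ua2]; apply: cvg_sum => i _.
  by apply: cvg_dot; apply: cvgB.
have a2E i : a.2 i = a.1.
  move: pa => /eqP; rewrite psumr_eq0 => [/allP /(_ i)|j _]; last exact: dot_ge0.
  by rewrite mem_index_enum => /(_ isT) /= /eqP /dot_eq0 /eqP; rewrite subr_eq0 => /eqP.
have a1E : a.1 = x0.
  have := r1P a.1 (le_trans Aa.1 rho1); move: ba; rewrite /b subrr normr0 dot0r mulr0.
  under eq_bigr do rewrite a2E.
  move=> /= h1 h2; apply/eqP; rewrite -subr_eq0 -normr_le0.
  have : e * `|a.1 - x0| <= 0 by lra.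
  by rewrite pmulr_rle0.
have near1 : \forall k \near U, `|(u k).1 - x0| < rho.
  have /cvgrPdist_lt /(_ rho rho0) := ua1.
  by apply: filterS => k; rewrite a1E distrC.
have near2 : \forall k \near U, forall i, `|(u k).2 i - x0| < rho.
  apply: filter_forall => i; have /cvgrPdist_lt /(_ rho rho0) := ua2 i.
  by apply: filterS => k; rewrite a2E a1E distrC.
have [k [k1 k2]] := near_ex2 near1 near2.
have [[Ak1 Ak2] kmin] := uP k.
pose x := (u k).1; pose y := (u k).2; pose K : R := k%:R.
(* With all but [y i] fixed, [phi i] plus its penalty is minimal at [y i]; minus the gradient of the
   penalty is this subgradient. *)
exists y, (fun i => (2 * K) *: (x - y i)); split=> [i|i|i|].
- exact: lt_le_trans (k2 i) rho2.
- by apply: le_trans rho3; exact: ltW.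
- apply: (@frechet_of_quadratic _ _ _ _ _ K) => //.
  apply: filterS (near_dist_le (k2 i)) => w wr.
  have /kmin : A (x, fun j => if j == i then w else y j).
    by split=> //= j; case: eqP.
  rewrite /b /p /= (sum_update phi) (sum_update (fun _ z => dot (x - z) (x - z))).
  have -> : x - w = (x - y i) - (w - y i) by rewrite opprB addrA subrK.
  by rewrite (dot_sqrB (x - y i)) dotZl !mulrDr; lra.
(* Now only [x] moves, by [h]: the penalty changes by the product of [h] with the sum of the
   subgradients, plus a remainder of constant [K * #|I|], and the tilt contributes [v] and the slope
   [e]. *)
apply/ler_addgt0Pr => e1 e10; rewrite distrC.
have C0 : 0 <= K * #|I|%:R by rewrite mulr_ge0.
have [r r_gt0 rP] := @quadratic_small _ d _ e1 C0 e10.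
have [r2 r20 r2P] := (near_distP _ _).1 (near_dist_le k1).
apply: (@norm_le_dot _ _ _ _ (Num.min r r2)).
- by rewrite addr_ge0 ?ltW.
- by rewrite lt_min r_gt0.
move=> h; rewrite le_min => /andP[/rP hr hr2].
have /kmin : A (x + h, y).
  by split=> //=; apply: r2P; rewrite addrC addKr.
rewrite /b /p /= -/x -/y -/K.
have -> : \sum_i dot (x + h - y i) (x + h - y i) =
    \sum_i dot (x - y i) (x - y i) + 2 * \sum_i dot (x - y i) h + #|I|%:R * dot h h.
  rewrite mulr_sumr mulr_natl -sumr_const -!big_split; apply: eq_bigr => i _ /=.
  have -> : x + h - y i = x - y i + h by rewrite addrAC.
  exact: dot_sqrD.
have -> : dot (v - \sum_i (2 * K) *: (x - y i)) h =
    dot v h - 2 * K * \sum_i dot (x - y i) h.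
  by rewrite dotBl -scaler_sumr dotZl dot_suml.
have -> : x + h - x0 = (x - x0) + h by rewrite addrAC.
have := ler_wpM2l (ltW e0) (ler_normD (x - x0) h).
rewrite (dotDr v (x - x0)) (mulrDl e e1) mulrDr.
move: hr; set S1 := \sum_i dot _ _; set S2 := \sum_i dot _ _ => hr.
have -> : K * (S1 + 2 * S2 + #|I|%:R * dot h h) =
    K * S1 + 2 * K * S2 + K * #|I|%:R * dot h h by ring.
by lra.
Unshelve. all: by end_near. Qed.

(** [fuzzy_sum_rule] with [e = 1 / (k + 1)], then a limit along an ultrafilter, which exists because
    a common Lipschitz constant bounds all subgradients. *)
Lemma sum_rule : (forall i, lipschitz_near (phi i) x0) ->
  frechet_subdifferential (fun x => \sum_i phi i x) x0 v ->
  exists2 u : I -> 'rV[R]_d,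
    forall i, limiting_subdifferential (phi i) x0 (u i) & \sum_i u i = v.
Proof.
move=> Lphi vphi.
have [L [r [L0 r0 lip]]] : exists L r : R, [/\ 0 <= L, 0 < r & forall i y z,
    `|y - x0| <= r -> `|z - x0| <= r -> `|phi i y - phi i z| <= L * `|y - z|].
  have /choice [Lr LrP] (i : I) : exists Lr : R * R, [/\ 0 < Lr.1, 0 < Lr.2 & forall y z,
      `|y - x0| <= Lr.2 -> `|z - x0| <= Lr.2 -> `|phi i y - phi i z| <= Lr.1 * `|y - z|].
    by have [L [r LrP]] := lipschitz_nearP (Lphi i); exists (L, r).
  exists (\sum_i (Lr i).1), (\big[Num.min/1]_i (Lr i).2); split.
  - by apply: sumr_ge0 => i _; have [/ltW] := LrP i.
  - by apply/bigmin_gtP; split=> // i _; have [] := LrP i.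
  move=> i y z yr zr; have [_ _ /(_ y z)] := LrP i.
  have le_r : \big[Num.min/1]_i (Lr i).2 <= (Lr i).2 by exact: bigmin_le.
  move=> /(_ (le_trans yr le_r) (le_trans zr le_r)) /le_trans; apply.
  rewrite ler_wpM2r // (bigD1 i) //= lerDl.
  by apply: sumr_ge0 => j _; have [/ltW] := LrP j.
have [U [UU ooU]] := @ultraFilterLemma nat \oo _.
have /choice [yu yuP] (k : nat) : exists yu : (I -> 'rV[R]_d) * (I -> 'rV[R]_d),
    [/\ forall i, `|yu.1 i - x0| < r, forall i, `|yu.1 i - x0| <= k.+1%:R^-1,
        forall i, frechet_subdifferential (phi i) (yu.1 i) (yu.2 i) &
        `|\sum_i yu.2 i - v| <= k.+1%:R^-1].
  have [|y [u yu]] := @fuzzy_sum_rule L r k.+1%:R^-1 L0 r0 _ lip vphi.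
    by rewrite invr_gt0.
  by exists (y, u).
have bnd i : \forall k \near U, `|(yu k).2 i| <= L.
  near=> k; have [yr _ /(_ i) uf _] := yuP k.
  apply: (frechet_subdifferential_bound L0 _ uf).
  apply/near_distP; exists (r - `|(yu k).1 i - x0|); first by rewrite subr_gt0.
  move=> w wy; apply: lip; last exact: ltW.
  by have := ler_distD ((yu k).1 i) w x0; lra.
have [u uP] := @ultra_family_cvg _ _ U _ I (fun=> d) (fun k => (yu k).2) (fun=> L) bnd.
exists u => [i|].
  apply: (@limiting_subdifferential_closed _ _ U _ _ _ (fun k => (yu k).1 i)
    (fun k => (yu k).2 i)).
  - exact: lipschitz_near_continuous.
  - by apply: cvg_natSinv => // k; have [] := yuP k.
  - exact: uP.
  - by near=> k; apply: frechet_sub_limiting; have [] := yuP k.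
have sum_v : (fun k => \sum_i (yu k).2 i) @ U --> v.
  by apply: cvg_natSinv => // k; have [] := yuP k.
have sum_u : (fun k => \sum_i (yu k).2 i) @ U --> \sum_i u i.
  by apply: cvg_sum => i _; exact: uP.
exact: (cvg_unique _ sum_u sum_v).
Unshelve. all: by end_near. Qed.

End sum_rule.

Section limiting_nonempty.
Context {R : realType}.

(* The sum rule applied to [f + (- f)], whose subdifferential contains [0]. *)
Lemma limiting_subdifferential_nonempty d (f : 'rV[R]_d -> R) (x : 'rV[R]_d) :
  lipschitz_near f x -> limiting_subdifferential f x !=set0.
Proof.
move=> Lf.
pose phi (b : bool) y := if b then f y else - f y.
have lip b : lipschitz_near (phi b) x.
  case: b => //; move: Lf => [V xV fV]; exists V => //.
  rewrite /lipschitz_on in fV *; apply: filterS fV => M fM w /fM;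
  by rewrite /phi /= -opprD normrN.
have fr : frechet_subdifferential (fun y => \sum_b phi b y) x 0.
  move=> e e0; near=> y; rewrite !big_bool /phi /= !subrr dot0l addr0 sub0r.
  by rewrite oppr_le0 mulr_ge0 // ltW.
by have [u /(_ true) uf _] := sum_rule lip fr; exists (u true).
Unshelve. all: by end_near. Qed.

End limiting_nonempty.

(** * Normal cones of disjunctive sets *)

Section normal_cones.
Context {R : realType}.

Lemma regular_normal_of_quadratic q (G : set 'rV[R]_q) (x v : 'rV[R]_q) (C : R) :
  0 <= C -> G x ->
  (\forall y \near x, G y -> dot v (y - x) <= C * dot (y - x) (y - x)) ->
  regular_normal_cone G x v.
Proof.
move=> C0 Gx vG; split=> // e e0.
have [r r0 rP] := @quadratic_small _ q C e C0 e0.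
have rnear : \forall y \near x, C * dot (y - x) (y - x) <= e * `|y - x|.
  by apply/near_distP; exists r => // y; exact: rP.
by apply: filterS2 vG rnear => y vy le_e /vy /le_trans; apply.
Qed.

(** Expanding the square about [z] turns the nearest-point property into [2 * dot (y - z) (w - z) <=
    dot (w - z) (w - z)], a quadratic normal inequality. *)
Lemma proximal_normal q (G : set 'rV[R]_q) (y z : 'rV[R]_q) (a : R) :
  0 <= a -> G z ->
  (\forall w \near z, G w -> dot (y - z) (y - z) <= dot (y - w) (y - w)) ->
  regular_normal_cone G z (a *: (y - z)).
Proof.
move=> a0 Gz zmin; apply: (regular_normal_of_quadratic a0 Gz).
apply: filterS zmin => w wP /wP.
have -> : y - w = (y - z) - (w - z) by rewrite opprB addrA subrK.
rewrite (dot_sqrB (y - z)) dotZl => H.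
by rewrite ler_wpM2l //; have := dot_ge0 (w - z); lra.
Qed.

Lemma regular_normal0 q (G : set 'rV[R]_q) (x : 'rV[R]_q) :
  G x -> regular_normal_cone G x 0.
Proof.
move=> Gx; split=> // e e0; apply: filterE => y _.
by rewrite dot0l mulr_ge0 // ltW.
Qed.

(** The normal vector is fixed and only the base point tends to [x]: the situation of one cone
    recurring at nearby points. *)
Lemma limiting_normal_of_regular q (G : set 'rV[R]_q) (x v : 'rV[R]_q) :
  G x -> (forall e : R, 0 < e -> exists2 y, `|y - x| <= e & regular_normal_cone G y v) ->
  limiting_normal_cone G x v.
Proof.
move=> Gx H; split=> //.
have /choice [y yP] (k : nat) : exists y,
    `|y - x| <= k.+1%:R^-1 /\ regular_normal_cone G y v.
  by have [|y yx yv] := H k.+1%:R^-1; [rewrite invr_gt0|exists y].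
exists y, (fun=> v); split; [| exact: cvg_cst | |].
- by apply: cvg_natSinv => // k; have [] := yP k.
- by move=> k; have [_ []] := yP k.
- by move=> k; have [_] := yP k.
Qed.

(** Centred at [0], so that the same displacement [h] can be tried at two different points. *)
Lemma regular_normal_coneP q (G : set 'rV[R]_q) (x v : 'rV[R]_q) :
  regular_normal_cone G x v <-> G x /\ forall e : R, 0 < e ->
    \forall h \near (0 : 'rV[R]_q), G (x + h) -> dot v h <= e * `|h|.
Proof.
split=> -[Gx H]; split=> // e /H /near_distP [r r0 rP]; apply/near_distP;
  exists r => // y yr.
  have := rP (x + y); rewrite [x + y]addrC addrK; apply.
  by move: yr; rewrite subr0.
by move=> Gy; apply: rP; rewrite ?subr0 // addrC subrK.
Qed.

(** One of the finitely many polyhedra contains [u k] along [U], and its inequalities pass to the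
    limit. *)
Lemma disjunctive_closed q (G : set 'rV[R]_q) T (U : set_system T)
    {UU : UltraFilter U} (u : T -> 'rV[R]_q) (a : 'rV[R]_q) :
  disjunctive_set G -> (forall k, G (u k)) -> u @ U --> a -> G a.
Proof.
move=> [N [C [polyC ->]]] Gu ua.
have /choice [r rP] k : exists r, C r (u k) by have [r _] := Gu k; exists r.
have [r0 r0P] := @ultra_constant _ U _ _ r; exists r0 => //.
have [n [c [b Cr0]]] := polyC r0; rewrite Cr0 => i.
have cu : (fun k => dot (c i) (u k)) @ U --> dot (c i) a.
  by apply: cvg_dot => //; exact: cvg_cst.
apply: (cvgr_to_le cu); apply: filterS r0P => k rk.
by have := rP k; rewrite rk Cr0; apply.
Qed.

(* The regular normal cone at [x] only depends on which of the finitely many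
   inequalities defining [G] hold, or hold strictly, at [x]. *)
Lemma regular_normal_cones_finite q (G : set 'rV[R]_q) : disjunctive_set G ->
  exists (X : finType) (tau : 'rV[R]_q -> X), forall x y,
    G x -> G y -> tau x = tau y -> regular_normal_cone G x = regular_normal_cone G y.
Proof.
move=> [N [C [polyC GE]]].
pose D := {k : nat & (('I_k -> 'rV[R]_q) * ('I_k -> R))%type}.
have /choice [c cP] r : exists c : D,
    C r = [set y | forall i, dot ((projT2 c).1 i) y <= (projT2 c).2 i].
  by have [k [a [b Cr]]] := polyC r; exists (existT _ k (a, b)).
pose T : finType := {r : 'I_N & 'I_(projT1 (c r))}.
pose a (t : T) := (projT2 (c (tag t))).1 (tagged t).
pose b (t : T) := (projT2 (c (tag t))).2 (tagged t).
pose tau (x : 'rV[R]_q) := [ffun t : T => (dot (a t) x <= b t, dot (a t) x < b t)].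
exists {ffun T -> bool * bool}, tau => x y Gx Gy xy.
have GP z : G z <-> exists r, forall i : 'I_(projT1 (c r)),
    dot (a (Tagged (fun r => 'I_(projT1 (c r))) i)) z <= b (Tagged _ i).
  rewrite GE; split=> [[r _]|[r Hr]]; last by exists r => //; rewrite cP.
  by rewrite cP => H; exists r.
have near_lt (z : 'rV[R]_q) t : dot (a t) z < b t ->
    \forall h \near (0 : 'rV[R]_q), dot (a t) (z + h) < b t.
  move=> zt; have zlim : (fun h => dot (a t) (z + h)) @ nbhs (0 : 'rV[R]_q) --> dot (a t) z.
    rewrite -[in X in _ --> X](addr0 z).
    by apply: cvg_dot; [exact: cvg_cst | apply: cvgD; [exact: cvg_cst|exact: cvg_id]].
  exact: (cvgr_lt _ zlim).
have near_gt (z : 'rV[R]_q) t : b t < dot (a t) z ->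
    \forall h \near (0 : 'rV[R]_q), b t < dot (a t) (z + h).
  move=> zt; have zlim : (fun h => dot (a t) (z + h)) @ nbhs (0 : 'rV[R]_q) --> dot (a t) z.
    rewrite -[in X in _ --> X](addr0 z).
    by apply: cvg_dot; [exact: cvg_cst | apply: cvgD; [exact: cvg_cst|exact: cvg_id]].
  exact: (cvgr_gt _ zlim).
(* For small [h] an inequality that is strict, or violated, stays so at both points; where equality
   holds, only the sign of [dot (a t) h] matters, which is the same at both. *)
have loc : \forall h \near (0 : 'rV[R]_q), forall t,
    (dot (a t) (x + h) <= b t) = (dot (a t) (y + h) <= b t).
  apply: (@filter_forall _ T (fun t h =>
    (dot (a t) (x + h) <= b t) = (dot (a t) (y + h) <= b t))
    _ (nbhs_filter (0 : 'rV[R]_q))) => t.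
  have /ffunP /(_ t) := xy; rewrite !ffunE => -[Ele Elt].
  have [xt|xt|xt] := ltgtP (dot (a t) x) (b t).
  - have yt : dot (a t) y < b t by rewrite -Elt.
    by apply: filterS2 (near_lt _ _ xt) (near_lt _ _ yt) => h /ltW -> /ltW ->.
  - have yt : b t < dot (a t) y by rewrite ltNge -Ele -ltNge.
    apply: filterS2 (near_gt _ _ xt) (near_gt _ _ yt) => h.
    by rewrite !ltNge => /negbTE -> /negbTE ->.
  - have yt : dot (a t) y = b t.
      by apply/eqP; rewrite eq_le -Ele xt lexx /= leNgt -Elt xt ltxx.
    by apply: filterE => h; rewrite !dotDr xt yt.
have Gloc : \forall h \near (0 : 'rV[R]_q), G (x + h) <-> G (y + h).
  apply: filterS loc => h hP.
  by split=> /GP [r rP]; apply/GP; exists r => i; rewrite ?hP // -hP.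
apply/seteqP; split=> v /regular_normal_coneP [_ vP]; apply/regular_normal_coneP;
  split=> // e /vP; apply: filterS2 Gloc => h hG H.
  by move/hG; exact: H.
by move/hG; exact: H.
Qed.

End normal_cones.

(** * Linear independence of indexed families *)

Section indexed_families.
Context {R : realType} (V : vectType R) (T : choiceType).
Implicit Types (w : T -> V) (s : seq T) (c : T -> R).

Lemma span_mapP w s v : uniq s -> v \in <<map w s>>%VS ->
  exists c, v = \sum_(t <- s) c t *: w t.
Proof.
elim: s v => [|t s IH] v /=.
  by rewrite span_nil memv0 => _ /eqP ->; exists (fun=> 0); rewrite big_nil.
move=> /andP[ts us]; rewrite span_cons.
move=> /memv_addP [u /vlineP [k ->] [u' /(IH _ us) [c ->] ->]].
exists (fun z => if z == t then k else c z); rewrite big_cons eqxx; congr (_ + _).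
apply: eq_big_seq => z zs; case: eqP => // zt.
by move: ts; rewrite -zt zs.
Qed.

(** Coefficients belong to indices, not to vectors: two indices carrying the same vector make the
    family dependent, as in [RCPLD_family]. *)
Lemma free_mapP w s : uniq s -> free (map w s) <->
  forall c, \sum_(t <- s) c t *: w t = 0 -> forall t, t \in s -> c t = 0.
Proof.
elim: s => [|t s IH] /=; first by split=> // _; exact: nil_free.
move=> /andP[ts us]; rewrite free_cons; split=> [/andP[wt ws] c|H].
  rewrite big_cons => cw; have ct : c t = 0.
    apply: contraNeq wt => ct; have -> : w t = - (c t)^-1 *: \sum_(z <- s) c z *: w z.
      apply: (scalerI ct); rewrite scalerA mulrN divff // scaleN1r.
      by apply/eqP; rewrite -addr_eq0 cw.
    rewrite memvZ // big_seq memv_suml // => z zs.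
    by rewrite memvZ // memv_span // map_f.
  move: cw; rewrite ct scale0r add0r => cw z; rewrite inE => /orP[/eqP -> //|zs].
  by have /IH := ws; apply.
apply/andP; split.
  apply/negP => /(span_mapP us) [c wt].
  have := H (fun z => if z == t then -1 else c z); rewrite big_cons eqxx scaleN1r.
  have -> : \sum_(j <- s) (if j == t then -1 else c j) *: w j = w t.
    rewrite wt; apply: eq_big_seq => z zs; case: eqP => // zt.
    by move: ts; rewrite -zt zs.
  rewrite addNr => /(_ erefl t); rewrite mem_head eqxx => /(_ isT) /eqP.
  by rewrite oppr_eq0 oner_eq0.
apply/IH => // c cw z zs; have := H (fun z => if z == t then 0 else c z).
rewrite big_cons eqxx scale0r add0r.
have -> : \sum_(j <- s) (if j == t then 0 else c j) *: w j = 0.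
  rewrite -[RHS]cw; apply: eq_big_seq => z' zs'; case: eqP => // zt.
  by move: ts; rewrite -zt zs'.
move=> /(_ erefl z); rewrite inE zs orbT => /(_ isT); case: eqP => // zt.
by move: ts; rewrite -zt zs.
Qed.

Lemma free_map_sub w s s' : uniq s' -> uniq s -> {subset s' <= s} ->
  free (map w s) -> free (map w s').
Proof.
move=> us' us ss' fs.
suff /(perm_map w)/perm_free : perm_eq s (s' ++ [seq t <- s | t \notin s']).
  by rewrite fs map_cat => /esym /catl_free.
apply: uniq_perm => //.
  rewrite cat_uniq us' filter_uniq // andbT /=.
  by apply/hasPn => t; rewrite mem_filter => /andP[].
move=> t; rewrite mem_cat mem_filter; case: (boolP (t \in s')) => //= ts'.
exact: ss'.
Qed.

(* Move the coefficients along a linear dependency until the first coefficient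
   on [s2] vanishes: up to then no sign has changed. *)
Lemma caratheodory w s1 s2 c : uniq (s1 ++ s2) -> free (map w s1) ->
  exists (m : bitseq) (c' : T -> R), size m = size s2 /\ [/\
    free (map w (s1 ++ mask m s2)),
    \sum_(t <- s1 ++ s2) c t *: w t = \sum_(t <- s1 ++ mask m s2) c' t *: w t &
    forall t, t \in mask m s2 -> 0 <= c t -> 0 <= c' t].
Proof.
move=> us fs1.
(* The kept part is returned as a mask: masks of fixed length form a finite type, so the choice can
   be made constant along an ultrafilter. *)
suff [s' [c' [/subseqP [m sm ->] H]]] : exists s' c', subseq s' s2 /\ [/\
    free (map w (s1 ++ s')),
    \sum_(t <- s1 ++ s2) c t *: w t = \sum_(t <- s1 ++ s') c' t *: w t &
    forall t, t \in s' -> 0 <= c t -> 0 <= c' t].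
  by exists m, c'.
have [n] := ubnP (size s2); elim: n s2 c us => // n IH s2 c us sn.
have [fs|nfs] := boolP (free (map w (s1 ++ s2))).
  by exists s2, c; rewrite subseq_refl.
(* Since [s1] is independent, a dependency must charge some index of [s2]; the index removed is
   therefore always taken from [s2]. *)
have [e [ew [t0 t0s et0]]] : exists e, \sum_(t <- s1 ++ s2) e t *: w t = 0 /\
    exists2 t, t \in s2 & e t != 0.
  apply: contrapT => /forallNP ne; move/negP: nfs; apply; apply/(free_mapP _ us).
  move=> e ew; have e2 t : t \in s2 -> e t = 0.
    by move=> ts; apply: contra_notP (ne e) => /eqP et; split=> //; exists t.
  have e1 : \sum_(t <- s1) e t *: w t = 0.
    move: ew; rewrite big_cat /= [X in _ + X]big_seq [X in _ + X]big1 ?addr0 //.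
    by move=> t ts; rewrite e2 // scale0r.
  have us1 : uniq s1 by move: us; rewrite cat_uniq => /andP[].
  move=> t; rewrite mem_cat => /orP[|]; last exact: e2.
  exact: (free_mapP w us1).1 fs1 e e1 t.
(* The least ratio marks the first coefficient to vanish; it gives [|th * e t| <= |c t|] on [s2],
   which preserves signs. *)
pose r t := `|c t| / `|e t|.
have [t1 [t1s et1 t1min]] : exists t1, [/\ t1 \in s2, e t1 != 0 &
    forall t, t \in s2 -> e t != 0 -> r t1 <= r t].
  have t0f : t0 \in [seq t <- s2 | e t != 0] by rewrite mem_filter et0.
  pose F (t : seq_sub [seq t <- s2 | e t != 0]) := r (ssval t).
  have [[t1 t1f] _ t1m] := @arg_minP _ R _ (SeqSub t0f) xpredT F isT.
  exists t1; move: (t1f); rewrite mem_filter => /andP[et1 t1s]; split=> // t ts et.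
  have tf : t \in [seq t <- s2 | e t != 0] by rewrite mem_filter et.
  exact: (t1m (SeqSub tf)).
pose th := c t1 / e t1.
pose c1 t := c t - th * e t.
have c1t1 : c1 t1 = 0 by rewrite /c1 /th mulfVK // subrr.
have c1sign t : t \in s2 -> 0 <= c t -> 0 <= c1 t.
  move=> ts ct; rewrite /c1; have [->|et] := eqVneq (e t) 0.
    by rewrite mulr0 subr0.
  have := t1min t ts et; rewrite /r -normfV -normrM -/th ler_pdivlMr ?normr_gt0 //.
  by rewrite -normrM (ger0_norm ct) subr_ge0 => /(le_trans (ler_norm _)).
have perm2 : perm_eq s2 (t1 :: rem t1 s2) by exact: perm_to_rem.
have perm12 : perm_eq (s1 ++ s2) (t1 :: s1 ++ rem t1 s2).
  rewrite -[t1 :: s1 ++ _]/([:: t1] ++ s1 ++ _) perm_sym perm_catCA perm_cat2l.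
  by rewrite perm_sym.
have us' : uniq (s1 ++ rem t1 s2) by move: us; rewrite (perm_uniq perm12) => /andP[].
have [|s' [c' [ss' [fs' cE c's]]]] := IH (rem t1 s2) c1 us'.
  by rewrite size_rem //; case: (s2) t1s sn.
exists s', c'; split; first exact: subseq_trans ss' (rem_subseq _ _).
have sub2 t : t \in s' -> t \in s2.
  by move=> /(mem_subseq ss') /mem_rem.
split=> //; last by move=> t ts' ct; apply: c's => //; exact: c1sign (sub2 t ts') ct.
have -> : \sum_(t <- s1 ++ s2) c t *: w t = \sum_(t <- s1 ++ s2) c1 t *: w t.
  apply/eqP; rewrite -subr_eq0 -sumrB.
  rewrite (eq_bigr (fun t => th *: (e t *: w t))) => [|t _].
    by rewrite -scaler_sumr ew scaler0.
  by rewrite -scalerBl /c1 opprB addrC subrK scalerA.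
by rewrite -cE (perm_big _ perm12) /= big_cons c1t1 scale0r add0r.
Qed.

End indexed_families.

(** * Independence in the limit and selection of a basis *)

Section limits_of_families.
Context {R : realType}.

Lemma ultra_coef_cvg T (U : set_system T) {UU : UltraFilter U} (I : Type)
    (c : T -> I -> R) :
  (forall i, \forall k \near U, `|c k i| <= 1) ->
  exists a : I -> R, forall i, (fun k => c k i) @ U --> a i.
Proof.
move=> c1; pose H (i : I) := cid2 (@ultra_bounded_cvgR _ U UU _ _ _ (c1 i)).
by exists (fun i => s2val (H i)) => i; case: (H i).
Qed.

(** Independence is an open condition: dependencies scaled so that the absolute coefficients sum to
    [1] would converge to a nontrivial dependency of [w0]. *)
Lemma free_map_limit T (U : set_system T) {UU : UltraFilter U} d (I : choiceType)
    (s : seq I) (w : T -> I -> 'rV[R]_d) (w0 : I -> 'rV[R]_d) :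
  uniq s -> (forall i, i \in s -> (fun k => w k i) @ U --> w0 i) ->
  free (map w0 s) -> \forall k \near U, free (map (w k) s).
Proof.
move=> us ww0 /(free_mapP w0 us) fw0.
have [//|nfree] := @ultra_dichotomy _ U _ (fun k => free (map (w k) s)).
have /choice [c cP] k : exists c : I -> R, ~ free (map (w k) s) ->
    \sum_(i <- s) c i *: w k i = 0 /\ \sum_(i <- s) `|c i| = 1.
  have [fk|nfk] := pselect (free (map (w k) s)); first by exists (fun=> 0).
  have [c [cw [i is_ ci]]] : exists c, \sum_(i <- s) c i *: w k i = 0 /\
      exists2 i, i \in s & c i <> 0.
    apply: contrapT => /forallNP nc; apply: nfk; apply/(free_mapP _ us) => c cw i is_.
    by apply: contra_notP (nc c) => ci; split=> //; exists i.
  pose M := \sum_(i <- s) `|c i|.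
  have M0 : 0 < M.
    rewrite lt_neqAle sumr_ge0 // andbT eq_sym psumr_eq0 //.
    by apply/allPn; exists i => //=; rewrite normr_eq0; exact/eqP.
  exists (fun i => M^-1 * c i) => _; split.
    by under eq_bigr do rewrite -scalerA; rewrite -scaler_sumr cw scaler0.
  under eq_bigr do rewrite normrM gtr0_norm ?invr_gt0 //.
  by rewrite -mulr_sumr mulVf // gt_eqF.
have cs k i : ~ free (map (w k) s) -> i \in s -> `|c k i| <= 1.
  move=> /cP [_ <-] is_; rewrite (big_rem i) //= lerDl.
  exact: sumr_ge0.
have [|a ca] := @ultra_coef_cvg _ U _ I (fun k i => if i \in s then c k i else 0).
  move=> i; apply: filterS nfree => k nk; case: ifP; last by rewrite normr0.
  by move=> /(cs _ _ nk).
have ca' i : i \in s -> (fun k => c k i) @ U --> a i.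
  by move=> is_; have := ca i; rewrite is_.
have aw : \sum_(i <- s) a i *: w0 i = 0.
  have lim : (fun k => \sum_(i <- s | i \in s) c k i *: w k i) @ U -->
      \sum_(i <- s | i \in s) a i *: w0 i.
    by apply: cvg_sum => i is_; apply: cvgZ; [exact: ca' | exact: ww0].
  rewrite big_seq; apply: (cvg_unique (@norm_hausdorff _ _) lim).
  apply: cvg_near_cst.
  near=> k; rewrite -big_seq.
  suff /cP [] : ~ free (map (w k) s) by [].
  by near: k.
have lim0 : (fun k => \sum_(i <- s | i \in s) `|c k i|) @ U -->
    \sum_(i <- s | i \in s) `|a i|.
  by apply: cvg_sum => i is_; apply: cvg_norm; exact: ca'.
have lim1 : (fun k => \sum_(i <- s | i \in s) `|c k i|) @ U --> (1 : R).
  apply: cvg_near_cst; near=> k; rewrite -big_seq.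
  suff /cP [] : ~ free (map (w k) s) by [].
  by near: k.
have a0 : \sum_(i <- s | i \in s) `|a i| = 0.
  by rewrite big1 // => i is_; rewrite (fw0 _ aw) // normr0.
have one0 : 1 = 0 :> R by rewrite -[RHS]a0; exact: cvg_unique lim1 lim0.
by have /eqP := one0; rewrite oner_eq0.
Unshelve. all: by end_near. Qed.

End limits_of_families.

(** Greedy selection along the list; the result is a set of indices because that is how [J] enters
    MPDC-RCPLD. *)
Lemma basis_subfamily (R : realType) (V : vectType R) (I : finType) (w : I -> V) :
  exists J : {set I}, basis_of <<[seq w i | i <- enum I]>>%VS [seq w i | i <- enum J].
Proof.
suff H s : uniq s -> exists s', [/\ uniq s', {subset s' <= s} &
    basis_of <<map w s>>%VS (map w s')].
  have [s' [us' _ bs']] := H _ (enum_uniq I); exists [set i in s'].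
  rewrite (perm_basis (Y := map w s')) //; apply: perm_map.
  apply: uniq_perm => //; first exact: enum_uniq.
  by move=> i; rewrite mem_enum inE.
elim: s => [_|t s IH /= /andP[ts /IH [s' [us' ss' bs']]]].
  by exists [::]; split=> //; rewrite /= span_nil nil_basis.
have /andP[/eqP spans' fs'] := bs'; rewrite span_cons.
have [wt|wt] := boolP (w t \in <<map w s>>%VS).
  exists s'; split=> //; first by move=> z /ss'; rewrite inE orbC => ->.
  suff -> : (<[w t]> + <<map w s>> = <<map w s>>)%VS by [].
  by apply/addv_idPr; rewrite -memvE.
exists (t :: s'); split.
- by rewrite /= us' andbT; apply: contra ts; exact: ss'.
- by move=> z; rewrite !inE => /orP[->//|/ss' ->]; rewrite orbT.
by rewrite /basis_of /= span_cons spans' eqxx free_cons spans' wt.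
Qed.

(** * First-order optimality of the penalized problems *)

Section upper_gradients.
Context {R : realType}.

(** A Frechet supergradient. At a minimum of a sum, an upper estimate of one summand becomes a lower
    estimate, hence a subgradient, for the other. *)
Definition upper_gradient d (F : 'rV[R]_d -> R) (x v : 'rV[R]_d) : Prop :=
  forall e : R, 0 < e ->
    \forall y \near x, F y <= F x + dot v (y - x) + e * `|y - x|.

Lemma upper_gradientD d (F G : 'rV[R]_d -> R) x v w :
  upper_gradient F x v -> upper_gradient G x w ->
  upper_gradient (fun y => F y + G y) x (v + w).
Proof.
move=> Fv Gw e e0; have e2 : 0 < e / 2 by rewrite divr_gt0.
apply: filterS2 (Fv _ e2) (Gw _ e2) => y; rewrite dotDl.
have -> : e / 2 * `|y - x| = e * `|y - x| / 2 by rewrite mulrAC.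
by lra.
Qed.

Lemma upper_gradientZ d (F : 'rV[R]_d -> R) x v (a : R) : 0 <= a ->
  upper_gradient F x v -> upper_gradient (fun y => a * F y) x (a *: v).
Proof.
move=> a0 Fv e e0; have a1 : 0 < a + 1 by rewrite ltr_wpDl.
apply: filterS (Fv (e / (a + 1)) (divr_gt0 e0 a1)) => y /(ler_wpM2l a0) /le_trans; apply.
have ae : a * (e / (a + 1)) <= e.
  by rewrite mulrCA ler_piMr ?(ltW e0) // ler_pdivrMr // mul1r lerDl.
by rewrite dotZl !mulrDr lerD2l mulrA ler_wpM2r.
Qed.

Lemma upper_gradient_sum d I (r : seq I) (F : I -> 'rV[R]_d -> R) x
    (v : I -> 'rV[R]_d) :
  (forall i, upper_gradient (F i) x (v i)) ->
  upper_gradient (fun y => \sum_(i <- r) F i y) x (\sum_(i <- r) v i).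
Proof.
move=> Fv; elim: r => [|i r IH].
  rewrite big_nil => e e0; apply: filterE => y; rewrite !big_nil dot0l !add0r.
  by rewrite mulr_ge0 // ltW.
rewrite big_cons => e e0.
apply: filterS (upper_gradientD (Fv i) IH e0) => y.
by rewrite !big_cons.
Qed.

Lemma upper_gradient_quadratic d (F : 'rV[R]_d -> R) (x v : 'rV[R]_d) (C : R) :
  0 <= C -> (\forall y \near x,
    F y <= F x + dot v (y - x) + C * dot (y - x) (y - x)) ->
  upper_gradient F x v.
Proof.
move=> C0 Fv e e0; have [r r0 rP] := @quadratic_small _ d C e C0 e0.
have rnear : \forall y \near x, C * dot (y - x) (y - x) <= e * `|y - x|.
  by apply/near_distP; exists r => // y; exact: rP.
by apply: filterS2 Fv rnear => y; lra.
Qed.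

Lemma frechet_of_minimum d (S H : 'rV[R]_d -> R) (x v : 'rV[R]_d) :
  upper_gradient H x v -> (\forall y \near x, S x + H x <= S y + H y) ->
  frechet_subdifferential S x (- v).
Proof.
move=> Hv xmin e e0; apply: filterS2 (Hv e e0) xmin => y.
by rewrite dotNl; lra.
Qed.

Lemma differentiable_near d q (F : 'rV[R]_d -> 'rV[R]_q) (x : 'rV[R]_d) (e : R) :
  differentiable F x -> 0 < e ->
  \forall y \near x, `|F y - F x - (y - x) *m 'J F x| <= e * `|y - x|.
Proof.
move=> dF e0; have /eqaddoP := diff_locally dF.
move=> /(_ e e0) /near_distP [r r0 rP]; apply/near_distP; exists r => // y yx.
have := rP (y - x); rewrite subr0 => /(_ yx) /=.
by rewrite mul_rV_lin1 /= -![in X in X <= _ -> _]/(_ _) !fctE /= subrK opprD addrA.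
Qed.

Lemma upper_gradient_sqr_residual d q (F : 'rV[R]_d -> 'rV[R]_q)
    (x : 'rV[R]_d) (c : 'rV[R]_q) :
  differentiable F x ->
  upper_gradient (fun y => dot (F y - c) (F y - c)) x
    (2 *: adjoint_jacobian F x (F x - c)).
Proof.
move=> dF e e0.
set a := F x - c; set J := 'J F x.
(* [A] exceeds the factor by which the cross term amplifies the linearization error; accuracy
   [e / 2 / A] leaves the other half of [e] for [dot D D]. *)
pose A := q%:R * `|a| * 2 + 1.
have A0 : 0 < A by rewrite ltr_wpDl // !mulr_ge0.
have [B B0 BP] : exists2 B : R, 0 < B & forall h : 'rV[R]_d, `|h *m J| <= B * `|h|.
  pose B0 := \sum_i \sum_j `|J i j|; exists (B0 + 1).
    by rewrite ltr_wpDl //; apply: sumr_ge0 => i _; exact: sumr_ge0.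
  move=> h; apply: norm_le_coord => [|j].
    by rewrite mulr_ge0 // addr_ge0 //; apply: sumr_ge0 => i _; exact: sumr_ge0.
  rewrite mxE (le_trans (ler_norm_sum _ _ _)) // mulrDl mul1r.
  apply: (@le_trans _ _ (B0 * `|h|)); last by rewrite lerDl.
  rewrite mulr_suml ler_sum // => i _; rewrite normrM mulrC ler_pM ?norm_coord //.
  by rewrite (bigD1 j) //= lerDl sumr_ge0.
have e1 : 0 < e / 2 / A by rewrite !divr_gt0.
have near1 := differentiable_near dF e1.
have near2 := differentiable_near dF ltr01.
(* [|D| <= (B + 1) * |h|], where [B] bounds the Jacobian and [1] is the linearization error in
   [near2]; [q] comes from [dot_norm_le]. *)
pose C := q%:R * (B + 1) ^+ 2.
have C0 : 0 < C + 1 by rewrite ltr_wpDl // mulr_ge0 // sqr_ge0.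
have near3 : \forall y \near x, `|y - x| <= e / 2 / (C + 1).
  by apply/near_distP; exists (e / 2 / (C + 1)); rewrite // !divr_gt0.
apply: filterS3 near1 near2 near3 => y y1 y2 y3.
set h := y - x in y1 y2 y3 *; set D := F y - F x in y1 y2 *.
have -> : F y - c = a + D by rewrite /a /D [RHS]addrC addrA subrK.
rewrite dot_sqrD dotZl dot_adjoint_jacobian -/J.
have DB : `|D| <= (B + 1) * `|h|.
  rewrite -(subrK (h *m J) D) (le_trans (ler_normD _ _)) // mulrDl addrC lerD //.
have t1 : dot a D - dot a (h *m J) <= q%:R * `|a| * (e / 2 / A * `|h|).
  rewrite -dotBr (le_trans (ler_norm _)) // (le_trans (dot_norm_le _ _)) //.
  by rewrite ler_wpM2l // mulr_ge0.
have t2 : dot D D <= e / 2 * `|h|.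
  rewrite (le_trans (ler_norm _)) // (le_trans (dot_norm_le _ _)) //.
  apply: (@le_trans _ _ (C * `|h| * `|h|)).
    have -> : C * `|h| * `|h| = q%:R * (((B + 1) * `|h|) * ((B + 1) * `|h|)).
      by rewrite /C; ring.
    by rewrite -mulrA ler_wpM2l // ler_pM.
  rewrite ler_wpM2r //; move: y3; rewrite ler_pdivlMr //.
  by apply: le_trans; rewrite mulrC ler_wpM2l // lerDl.
have t3 : q%:R * `|a| * (e / 2 / A * `|h|) * 2 <= e / 2 * `|h|.
  have -> : q%:R * `|a| * (e / 2 / A * `|h|) * 2 =
    (e / 2 * `|h|) * ((q%:R * `|a| * 2) / A) by ring.
  have eh : 0 <= e / 2 * `|h| by rewrite mulr_ge0 // divr_ge0 // ltW.
  by rewrite ler_piMr // ler_pdivrMr // mul1r lerDl.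
by lra.
Qed.

(** The descent inequality of [max(t, 0)^2], whose derivative [2 max(t, 0)] is Lipschitz with
    constant [2]. *)
Lemma pos_part_sqr_le (a b : R) :
  Num.max a 0 ^+ 2 <= Num.max b 0 ^+ 2 + 2 * Num.max b 0 * (a - b) + (a - b) ^+ 2.
Proof.
have a2 := sqr_ge0 a; have ab2 := sqr_ge0 (a - b).
rewrite !expr2 in a2 ab2 *.
by case: (leP a 0) => ha; case: (leP b 0) => hb; nra.
Qed.

Lemma pos_part_dist (a b : R) : `|Num.max a 0 - Num.max b 0| <= `|a - b|.
Proof.
case: (leP a 0) => ha; case: (leP b 0) => hb.
- by rewrite subrr normr0.
- by rewrite sub0r normrN gtr0_norm // ler0_norm; lra.
- by rewrite subr0 gtr0_norm // gtr0_norm; lra.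
- by [].
Qed.

(* [max(g,0)^2 <= (g - t)^2] for all [t <= 0]; take [t = min(g x, 0)]. *)
Lemma upper_gradient_pos_part d (g : 'rV[R]_d -> R) (x : 'rV[R]_d) :
  lipschitz_near g x ->
  upper_gradient (fun y => Num.max (g y) 0 ^+ 2 - 2 * Num.max (g x) 0 * g y) x 0.
Proof.
move=> /lipschitz_nearP [L [r [L0 r0 Lg]]].
apply: (@upper_gradient_quadratic _ _ _ _ (L ^+ 2)); first exact: sqr_ge0.
apply/near_distP; exists r => // y yr; rewrite dot0l addr0.
have := pos_part_sqr_le (g y) (g x).
have : (g y - g x) ^+ 2 <= L ^+ 2 * dot (y - x) (y - x).
  apply: (@le_trans _ _ (L ^+ 2 * `|y - x| ^+ 2)).
    rewrite -exprMn -real_normK ?num_real // ler_sqr ?nnegrE ?mulr_ge0 ?(ltW L0) //.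
    by apply: Lg; rewrite // subrr normr0 ltW.
  by rewrite ler_wpM2l ?sqr_ge0 // sqr_norm_le_dot.
by lra.
Qed.

End upper_gradients.

(** [J] indexes as many vectors as the rank at the base point; if the rank is unchanged and these
    vectors are still independent, they span the whole family. *)
Lemma span_constant_rank (R : realType) (V : vectType R) (I : finType)
    (w0 w : I -> V) (J : {set I}) :
  basis_of <<[seq w0 i | i <- enum I]>>%VS [seq w0 i | i <- enum J] ->
  \dim <<[seq w i | i <- enum I]>>%VS = \dim <<[seq w0 i | i <- enum I]>>%VS ->
  free [seq w i | i <- enum J] ->
  forall c : I -> R, \sum_i c i *: w i \in <<[seq w i | i <- enum J]>>%VS.
Proof.
move=> /andP[/eqP span0 _] rk fJ c; rewrite memv_suml // => i _; rewrite memvZ //.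
have : basis_of <<[seq w i | i <- enum I]>>%VS [seq w i | i <- enum J].
  rewrite basisEfree fJ /= rk; apply/andP; split.
    by apply: sub_span => u /mapP [j _ ->]; apply: map_f; rewrite mem_enum.
  by rewrite size_map -(size_map w0) -span0 dim_span.
by move=> /span_basis ->; rewrite memv_span // map_f // mem_enum.
Qed.

Lemma big_option (V : nmodType) (I : finType) (F : option I -> V) :
  \sum_o F o = F None + \sum_i F (Some i).
Proof.
rewrite (bigD1 None) //=; congr (_ + _).
rewrite (reindex_omap Some id) /=; last by case.
by apply: eq_bigl => i; rewrite eqxx.
Qed.

Section penalization.
Context {R : realType} (d n m l : nat) (p : 'I_l -> nat).
Context (f : 'rV[R]_d -> R) (g : 'rV[R]_d -> 'rV[R]_n) (h : 'rV[R]_d -> 'rV[R]_m).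
Context (Phi : forall i : 'I_l, 'rV[R]_d -> 'rV[R]_(p i)).
Context (Gamma : forall i : 'I_l, set 'rV[R]_(p i)) (xbar : 'rV[R]_d).
Arguments Gamma : clear implicits.

(** The perturbation [2 *: (x - xbar)] is the gradient of the proximal term. [ps_active] later kills
    the multipliers of constraints inactive at [xbar]; [ps_center] settles the iterates equal to
    [xbar], which MPDC-RCPLD never tests. *)
Record perturbed_stationary (x : 'rV[R]_d) (z eta : forall i : 'I_l, 'rV[R]_(p i))
    (lam : 'rV[R]_n) (mu : 'rV[R]_m) (v0 : 'rV[R]_d) (v : 'I_n -> 'rV[R]_d) : Prop :=
  PerturbedStationary {
    ps_normal : forall i, regular_normal_cone (Gamma i) (z i) (eta i);
    ps_f : limiting_subdifferential f x v0;
    ps_g : forall i, limiting_subdifferential (fun y => g y 0 i) x (v i);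
    ps_ge0 : forall i, 0 <= lam 0 i;
    ps_active : forall i, lam 0 i != 0 -> 0 < g x 0 i;
    ps_eq : v0 + \sum_i lam 0 i *: v i + adjoint_jacobian h x mu
      + \sum_i adjoint_jacobian (Phi i) x (eta i) + 2 *: (x - xbar) = 0;
    ps_center : x = xbar -> [/\ lam = 0, mu = 0 & forall i, eta i = 0] }.

Context (g_lip : locally_lipschitz g).
Context (h_C1 : continuously_differentiable h).
Context (Phi_C1 : forall i, continuously_differentiable (Phi i)).
Context (Gamma_disj : forall i, disjunctive_set (Gamma i)).
Context (f_lip : lipschitz_near f xbar).
Context (xbar_sol : local_solution f (feasible g h Phi Gamma) xbar).

Lemma lipschitz_near_coord x i : lipschitz_near (fun y => g y 0 i) x.
Proof.
have [V xV gV] := g_lip x; exists V => //; rewrite /lipschitz_on in gV *.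
apply: filterS gV => M gM w /gM; apply: le_trans.
by have := norm_coord (g w.1 - g w.2) i; rewrite !mxE.
Qed.

Let X := ('rV[R]_d * (forall i : 'I_l, 'rV[R]_(p i)))%type.
Let b (w : X) := f w.1 + dot (w.1 - xbar) (w.1 - xbar).
Let pg (w : X) := \sum_i Num.max (g w.1 0 i) 0 ^+ 2.
Let ph (w : X) := dot (h w.1) (h w.1).
Let pPhi (w : X) := \sum_i dot (Phi i w.1 - w.2 i) (Phi i w.1 - w.2 i).
Let pen (w : X) := pg w + ph w + pPhi w.

Let pg_ge0 w : 0 <= pg w.
Proof. by apply: sumr_ge0 => i _; exact: sqr_ge0. Qed.

Let ph_ge0 w : 0 <= ph w.
Proof. exact: dot_ge0. Qed.

Let pPhi_ge0 w : 0 <= pPhi w.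
Proof. by apply: sumr_ge0 => i _; exact: dot_ge0. Qed.

Let pen_eq0 w : pen w = 0 -> [/\ forall i, Num.max (g w.1 0 i) 0 = 0,
  h w.1 = 0 & forall i, w.2 i = Phi i w.1].
Proof.
have := pg_ge0 w; have := ph_ge0 w; have := pPhi_ge0 w; rewrite /pen => a1 a2 a3 a4.
have /eqP g0 : pg w = 0 by lra.
have h0 : ph w = 0 by lra.
have /eqP P0 : pPhi w = 0 by lra.
split=> [i||i].
- move: g0; rewrite psumr_eq0 => [/allP /(_ i)|j _]; last exact: sqr_ge0.
  by rewrite mem_index_enum => /(_ isT) /=; rewrite sqrf_eq0 => /eqP.
- exact: dot_eq0.
move: P0; rewrite psumr_eq0 => [/allP /(_ i)|j _]; last exact: dot_ge0.
rewrite mem_index_enum => /(_ isT) /= /eqP /dot_eq0 /eqP.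
by rewrite subr_eq0 => /eqP.
Qed.

(* First-order optimality in [x] alone: the penalty on [g] is replaced by its
   linearization, so that only multiples of [g i] enter the sum rule. *)
Let stationary_x (k : R) (x : 'rV[R]_d) (z : forall i, 'rV[R]_(p i)) : 0 <= k ->
  lipschitz_near f x ->
  (\forall y \near x, b (x, z) + k * pen (x, z) <= b (y, z) + k * pen (y, z)) ->
  exists v0 v, [/\ limiting_subdifferential f x v0,
    forall i, limiting_subdifferential (fun y => g y 0 i) x (v i) &
    v0 + \sum_i (k * (2 * Num.max (g x 0 i) 0)) *: v i
      + adjoint_jacobian h x ((2 * k) *: h x)
      + \sum_i adjoint_jacobian (Phi i) x ((2 * k) *: (Phi i x - z i))
      + 2 *: (x - xbar) = 0].
Proof.
move=> k0 fx xmin.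
pose lam i := k * (2 * Num.max (g x 0 i) 0).
have lam0 i : 0 <= lam i by rewrite !mulr_ge0 // le_max lexx orbT.
(* [None] stands for [f], so a single sum rule covers [f] and all [g i]; the multiples of [g i]
   added here are those subtracted in [H]. *)
pose phi (o : option 'I_n) y := if o is Some i then lam i * g y 0 i else f y.
pose H y := dot (y - xbar) (y - xbar)
  + k * (\sum_i (Num.max (g y 0 i) 0 ^+ 2 - 2 * Num.max (g x 0 i) 0 * g y 0 i)
         + dot (h y - 0) (h y - 0)
         + \sum_i dot (Phi i y - z i) (Phi i y - z i)).
pose w := 2 *: (x - xbar) + k *: (\sum_(i < n) (0 : 'rV[R]_d)
  + 2 *: adjoint_jacobian h x (h x - 0)
  + \sum_i 2 *: adjoint_jacobian (Phi i) x (Phi i x - z i)).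
have Hw : upper_gradient H x w.
  apply: upper_gradientD.
    apply: (@upper_gradient_quadratic _ _ _ _ _ 1) => //; apply: filterE => y.
    have -> : y - xbar = (x - xbar) + (y - x) by rewrite [RHS]addrC addrA subrK.
    by rewrite dot_sqrD dotZl mul1r.
  apply: upper_gradientZ => //; apply: upper_gradientD; last first.
    apply: upper_gradient_sum => i; apply: upper_gradient_sqr_residual.
    by have [] := Phi_C1 i.
  apply: upper_gradientD.
    apply: upper_gradient_sum => i.
    exact: upper_gradient_pos_part (lipschitz_near_coord _ _).
  by apply: upper_gradient_sqr_residual; have [] := h_C1.
have objE y : \sum_o phi o y + H y = b (y, z) + k * pen (y, z).
  have lamE : \sum_i lam i * g y 0 i = k * \sum_i 2 * Num.max (g x 0 i) 0 * g y 0 i.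
    by rewrite mulr_sumr; apply: eq_bigr => i _; rewrite /lam !mulrA.
  by rewrite big_option /= lamE /H /b /pen /pg /ph /pPhi /= subr0 sumrB; ring.
have phi_lip o : lipschitz_near (phi o) x.
  case: o => [i|] //=.
  have [V xV gV] := lipschitz_near_coord x i; exists V => //.
  rewrite /lipschitz_on in gV *; have [M0 [_ M0P]] := gV.
  exists (lam i * (`|M0| + 1)); split; first exact: num_real.
  move=> M lM u /(M0P (`|M0| + 1)) - /(_ _) gu /=.
  rewrite -mulrBr normrM ger0_norm //.
  apply: (@le_trans _ _ (lam i * ((`|M0| + 1) * `|u.1 - u.2|))).
    by rewrite ler_wpM2l // gu // ltr_pwDr // ler_norm.
  by rewrite mulrA ler_wpM2r // ltW.
have : frechet_subdifferential (fun y => \sum_o phi o y) x (- w).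
  apply: frechet_of_minimum Hw _; apply: filterS xmin => y.
  by rewrite !objE.
move=> /(sum_rule phi_lip) [u up uw].
have /choice [v vP] i : exists v, limiting_subdifferential (fun y => g y 0 i) x v /\
    u (Some i) = lam i *: v.
  have [||v vg uv] := @limiting_subdifferential_scale _ _ (fun y => g y 0 i) x
    (u (Some i)) (lam i) (lam0 i).
  - exact: limiting_subdifferential_nonempty (lipschitz_near_coord _ _).
  - exact: up (Some i).
  - by exists v.
exists (u None), v; split; first exact: up None.
  by move=> i; have [] := vP i.
move: uw; rewrite big_option /= => uw.
rewrite (eq_bigr (fun i => u (Some i))) => [|i _]; last by have [_ ->] := vP i.
have hE : adjoint_jacobian h x ((2 * k) *: h x) = k *: (2 *: adjoint_jacobian h x (h x)).
  by rewrite adjoint_jacobianZ scalerA mulrC.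
have PhiE : \sum_i adjoint_jacobian (Phi i) x ((2 * k) *: (Phi i x - z i)) =
    k *: \sum_i 2 *: adjoint_jacobian (Phi i) x (Phi i x - z i).
  rewrite scaler_sumr; apply: eq_bigr => i _.
  by rewrite adjoint_jacobianZ scalerA mulrC.
rewrite uw hE PhiE /w subr0 sumr_const mul0rn add0r (scalerDr k) opprD.
by rewrite -[X in X + _ = 0]addrA subrK addNr.
Qed.

(** Only the [i]-th distance term varies, so for [k > 0] the point [z i] is locally nearest to
    [Phi i x] in [Gamma i]; for [k = 0] the multiplier is [0]. *)
Let stationary_z (k : R) (x : 'rV[R]_d) (z : forall i, 'rV[R]_(p i)) i : 0 <= k ->
  Gamma i (z i) ->
  (\forall w \near z i, Gamma i w ->
     b (x, z) + k * pen (x, z) <= b (x, dfwith z i w) + k * pen (x, dfwith z i w)) ->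
  regular_normal_cone (Gamma i) (z i) ((2 * k) *: (Phi i x - z i)).
Proof.
move=> k0 Gz zmin; have [->|kn0] := eqVneq k 0.
  by rewrite mulr0 scale0r; exact: regular_normal0.
have kgt0 : 0 < k by rewrite lt_neqAle eq_sym kn0.
apply: proximal_normal => //; first by rewrite mulr_ge0.
apply: filterS zmin => w wP /wP; rewrite /b /pen /pg /ph /pPhi /= lerD2l ler_pM2l //.
rewrite lerD2l (bigD1 i) //= [X in _ <= X -> _](bigD1 i) //= dfwithin.
rewrite [X in _ <= _ + X -> _](eq_bigr (fun j => dot (Phi j x - z j) (Phi j x - z j))).
  by rewrite lerD2r.
by move=> j ji; rewrite dfwithout // eq_sym.
Qed.

Lemma penalty_sequence (U : set_system nat) {UU : UltraFilter U} : \oo `<=` U ->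
  exists (x : nat -> 'rV[R]_d) (z eta : nat -> forall i, 'rV[R]_(p i))
    (lam : nat -> 'rV[R]_n) (mu : nat -> 'rV[R]_m)
    (v0 : nat -> 'rV[R]_d) (v : nat -> 'I_n -> 'rV[R]_d),
  [/\ x @ U --> xbar, forall i, (fun k => z k i) @ U --> Phi i xbar &
    \forall k \near U, perturbed_stationary (x k) (z k) (eta k) (lam k) (mu k)
      (v0 k) (v k)].
Proof.
move=> ooU; have [L [r1 [L0 r10 fL]]] := lipschitz_nearP f_lip.
have [[gbar hbar Gbar] /near_distP [r2 r20 fmin]] := xbar_sol.
pose rho := Num.min r1 r2.
have rho0 : 0 < rho by rewrite lt_min r10.
have rho1 : rho <= r1 by rewrite ge_min lexx.
have rho2 : rho <= r2 by rewrite ge_min lexx orbT.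
(* Closed balls give compactness. The radius in [x] stays where [f] is Lipschitz and [xbar] optimal;
   the radius [1] in [z] is arbitrary. *)
pose A : set X := [set w | `|w.1 - xbar| <= rho /\
  forall i, Gamma i (w.2 i) /\ `|w.2 i - Phi i xbar| <= 1].
pose conv (u : nat -> X) (a : X) := (fun k => (u k).1) @ U --> a.1 /\
  forall i, (fun k => (u k).2 i) @ U --> a.2 i.
pose xz0 : X := (xbar, fun i => Phi i xbar).
have pen_xz0 : pen xz0 = 0.
  rewrite /pen /pg /ph /pPhi /= hbar dot0l addr0 !big1 ?addr0 // => i _.
    by rewrite subrr dot0l.
  by rewrite max_r ?gbar // expr0n.
have contf (x : 'rV[R]_d) : `|x - xbar| < rho -> lipschitz_near f x.
  move=> xr; exists [set y | `|y - xbar| <= r1].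
    exact: near_dist_le (lt_le_trans xr rho1).
  exists L; split; first exact: num_real.
  move=> M /ltW LM [y1 y2] /= [y1r y2r].
  by apply: (le_trans (fL _ _ y1r y2r)); rewrite ler_wpM2r.
have C1_cvg q (F : 'rV[R]_d -> 'rV[R]_q) (w : nat -> 'rV[R]_d) (a : 'rV[R]_d) :
    continuously_differentiable F -> w @ U --> a -> F \o w @ U --> F a.
  move=> [dF _] wa; exact: (@cvg_comp _ _ _ w F _ _ _ wa
    (differentiable_continuous (dF a))).
have [|||u|u a Au Aa [ua1 ua2]|u a Au Aa [ua1 ua2]|u [a [uP Aa [ua1 ua2] pa ba]]] :=
  @penalty_minimizers R U UU X A conv b pen xz0 ooU.
- by split=> /= [|i]; [rewrite subrr normr0 ltW | rewrite subrr normr0; split].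
- exact: pen_xz0.
- by move=> w _; rewrite /pen !addr_ge0.
- move=> Au.
  have [a1 _ ua1] := ultra_bounded_cvg (near_norm_le (F := U) (fun k => (Au k).1)).
  have [a2 ua2] := @ultra_family_cvg _ _ U _ 'I_l p (fun k => (u k).2) _
    (fun i => near_norm_le (F := U) (fun k => ((Au k).2 i).2)).
  exists (a1, a2) => //; split=> /= [|i].
    by apply: cvg_dist_le ua1 => k; have [] := Au k.
  split; last by apply: cvg_dist_le (ua2 i) => k; have [_ /(_ i) []] := Au k.
  by apply: disjunctive_closed (ua2 i) => // k; have [_ /(_ i) []] := Au k.
- rewrite /b; apply: cvgD; last first.
    by apply: cvg_dot; apply: cvgB => //; exact: cvg_cst.
  apply/cvgrPdist_le => e e0.
  have /cvgrPdist_le /(_ (e / L) (divr_gt0 e0 L0)) := ua1.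
  apply: filterS => k; rewrite ler_pdivlMr // mulrC => /(le_trans _); apply.
  by apply: fL; [exact: le_trans Aa.1 rho1 | exact: le_trans (Au k).1 rho1].
- rewrite /pen; apply: cvgD; [apply: cvgD|].
  + apply: cvg_sum => i _.
    have gu : (fun k => g (u k).1 0 i) @ U --> g a.1 0 i.
      exact: (@cvg_comp _ _ _ (fun k => (u k).1) (fun y => g y 0 i) _ _ _ ua1
        (lipschitz_near_continuous (lipschitz_near_coord a.1 i))).
    have gm : (fun k => Num.max (g (u k).1 0 i) 0) @ U --> Num.max (g a.1 0 i) 0.
      apply/cvgrPdist_le => e e0; move/cvgrPdist_le : gu => /(_ e e0).
      by apply: filterS => k; apply: le_trans; exact: pos_part_dist.
    exact: (cvgM gm gm).
  + by apply: cvg_dot; exact: C1_cvg ua1.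
  + apply: cvg_sum => i _.
    by apply: cvg_dot; apply: cvgB; [exact: C1_cvg ua1 | exact: ua2
      | exact: C1_cvg ua1 | exact: ua2].
have [ga ha a2E] := pen_eq0 pa.
(* The limit is feasible, so [f xbar <= f a.1]; against [b a <= b xz0] this leaves no room for the
   proximal term. *)
have a1E : a.1 = xbar.
  have /fmin : `|a.1 - xbar| <= r2 by apply: le_trans rho2; have [] := Aa.
  have Fa : feasible g h Phi Gamma a.1.
    split=> // i; first by have /eqP := ga i; rewrite eq_maxr.
    by rewrite -a2E; have [_ /(_ i) []] := Aa.
  move=> /(_ Fa) fa; move: ba; rewrite /b /= subrr dot0l addr0 => ba.
  apply/eqP; rewrite -subr_eq0; apply/eqP/dot_eq0.
  by have := dot_ge0 (a.1 - xbar); lra.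
(* Strictly inside the balls, minimality over [A] is local minimality in [x] and in each [z i]. *)
have near1 : \forall k \near U, `|(u k).1 - xbar| < rho.
  have /cvgrPdist_lt /(_ rho rho0) := ua1.
  by apply: filterS => k; rewrite a1E distrC.
have near2 : \forall k \near U, forall i, `|(u k).2 i - Phi i xbar| < 1.
  apply: filter_forall => i; have /cvgrPdist_lt /(_ 1 ltr01) := ua2 i.
  by apply: filterS => k; rewrite a2E a1E distrC.
have /choice [vv vvP] k : exists vv : 'rV[R]_d * ('I_n -> 'rV[R]_d),
    `|(u k).1 - xbar| < rho ->
    [/\ limiting_subdifferential f (u k).1 vv.1,
    forall i, limiting_subdifferential (fun y => g y 0 i) (u k).1 (vv.2 i) &
    vv.1 + \sum_i (k%:R * (2 * Num.max (g (u k).1 0 i) 0)) *: vv.2 i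
      + adjoint_jacobian h (u k).1 ((2 * k%:R) *: h (u k).1)
      + \sum_i adjoint_jacobian (Phi i) (u k).1 ((2 * k%:R) *: (Phi i (u k).1 - (u k).2 i))
      + 2 *: ((u k).1 - xbar) = 0].
  have [ur|] := pselect (`|(u k).1 - xbar| < rho); last by exists (0, fun=> 0).
  have [|||v0 [v vP]] := @stationary_x k%:R (u k).1 (u k).2; last by exists (v0, v).
  - by [].
  - exact: contf.
  - apply: filterS (near_dist_le ur) => y yr; have [Auk uk_min] := uP k.
    have -> : ((u k).1, (u k).2) = u k by case: (u k).
    by apply: uk_min; split=> //=; have [] := Auk.
exists (fun k => (u k).1), (fun k => (u k).2),
  (fun k i => (2 * k%:R) *: (Phi i (u k).1 - (u k).2 i)),
  (fun k => \row_i (k%:R * (2 * Num.max (g (u k).1 0 i) 0))),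
  (fun k => (2 * k%:R) *: h (u k).1), (fun k => (vv k).1), (fun k => (vv k).2).
split; [by rewrite -a1E | by move=> i; rewrite -a1E -a2E; exact: ua2 |].
apply: filterS2 near1 near2 => k k1 k2; have [[Auk1 Auk2] uk_min] := uP k.
have [vf vg veq] := vvP k k1.
have ukE : ((u k).1, (u k).2) = u k by case: (u k).
split=> //.
- move=> i; apply: stationary_z => //; first by have [] := Auk2 i.
  apply: filterS (near_dist_le (k2 i)) => w wr Gw; rewrite ukE.
  apply: uk_min; split=> //= j; have [<-|ij] := eqVneq i j; first by rewrite dfwithin.
  by rewrite dfwithout.
- by move=> i; rewrite mxE !mulr_ge0 // le_max lexx orbT.
- move=> i; rewrite mxE ltNge => nz; apply: contra nz => gle0.
  by rewrite max_r // !mulr0.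
- by under eq_bigr do rewrite mxE.
(* At [x k = xbar], comparison with [xz0] leaves [k * pen <= 0]: either [k] or every residual
   vanishes, and each multiplier contains both as factors. *)
have Axz0 : A xz0 by split=> /= [|i]; rewrite subrr normr0 ?(ltW rho0).
move=> ukx; have := uk_min xz0 Axz0.
rewrite pen_xz0 mulr0 addr0 /b ukx /= gerDl => kpen.
have : k%:R * pen (u k) = 0.
  by apply/eqP; rewrite eq_le kpen mulr_ge0 // /pen !addr_ge0.
move=> /eqP; rewrite mulf_eq0 => /orP[/eqP ->|/eqP /pen_eq0 [g0 h0 P0]].
  split; [by apply/rowP => i; rewrite !mxE mul0r | by rewrite mulr0 scale0r |].
  by move=> i; rewrite mulr0 scale0r.
split; [by apply/rowP => i; rewrite !mxE -ukx g0 !mulr0 | by rewrite -ukx h0 scaler0 |].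
by move=> i; rewrite P0 ukx subrr scaler0.
Qed.

End penalization.

(** * Reduction of the multipliers *)

Section generators.
Context {R : realType} (q : nat).
Implicit Types AI AE : {fset 'rV[R]_q}.

Lemma sum_fsetU_disjoint (V : nmodType) AI AE (F : 'rV[R]_q -> V) :
  [disjoint AI & AE]%fset ->
  \sum_(a <- enum_fset (AI `|` AE)%fset) F a =
  \sum_(a <- enum_fset AI) F a + \sum_(a <- enum_fset AE) F a.
Proof.
move=> dAIE; rewrite -big_cat; apply: perm_big; apply: uniq_perm.
- exact: fset_uniq.
- rewrite cat_uniq !fset_uniq andbT /=; apply/hasPn => a aE; apply/negP => aI.
  by move/fdisjointP : dAIE => /(_ a aI); rewrite aE.
by move=> a; rewrite mem_cat in_fsetU.
Qed.

(** Disjointness lets one coefficient function serve both parts, with a sign condition on [AI] only: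
    the shape on which [caratheodory] acts. *)
Lemma cone_plus_spanP AI AE u : [disjoint AI & AE]%fset ->
  cone_plus_span AI AE u <-> exists c : 'rV[R]_q -> R,
    (forall a, a \in AI -> 0 <= c a) /\
    u = \sum_(a <- enum_fset (AI `|` AE)%fset) c a *: a.
Proof.
move=> dAIE; split=> [[_ [c /= c0 <-] [w /= wE <-]]|[c [c0 ->]]].
  have [|e we] := @span_mapP R _ _ id (enum_fset AE) w (fset_uniq _).
    by rewrite map_id.
  exists (fun a => if a \in AI then c a else e a); split=> [a -> //|].
  rewrite sum_fsetU_disjoint // we; congr (_ + _); apply: eq_big_seq => a aA.
    by rewrite aA.
  case: ifP => // aI; move/fdisjointP : dAIE => /(_ a aI).
  by rewrite (_ : a \in AE).
exists (\sum_(a <- enum_fset AI) (if a \in AI then c a else 0) *: a).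
  exists (fun a => if a \in AI then c a else 0) => //= a.
  by case: ifP => [/c0|].
exists (\sum_(a <- enum_fset AE) c a *: a) => /=.
  by rewrite big_seq memv_suml // => a aE; rewrite memvZ // memv_span.
rewrite sum_fsetU_disjoint //; congr (_ + _); apply: eq_big_seq => a aA.
by rewrite (_ : a \in AI).
Qed.

Lemma fdisjoint_restrict AI AE (K : {fset 'rV[R]_q}) :
  [disjoint AI & AE]%fset -> [disjoint (AI `&` K) & (AE `&` K)]%fset.
Proof.
move=> /fdisjointP dA; apply/fdisjointP => a; rewrite !in_fsetI => /andP[aI _].
by rewrite (negbTE (dA a aI)).
Qed.

(** Coefficients extend by zero. Thus the generators that survive the reduction still span a subcone
    of the original normal cone, as MPDC-RCPLD demands. *)
Lemma cone_plus_span_restrict AI AE (K : {fset 'rV[R]_q}) :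
  [disjoint AI & AE]%fset ->
  cone_plus_span (AI `&` K)%fset (AE `&` K)%fset `<=` cone_plus_span AI AE.
Proof.
move=> dA u /(cone_plus_spanP _ (fdisjoint_restrict K dA)) [c [c0 ->]].
apply/cone_plus_spanP => //.
exists (fun a => if a \in K then c a else 0); split=> [a aI|].
  by case: ifP => // aK; apply: c0; rewrite in_fsetI aI.
rewrite -fsetIUl [RHS](bigID (fun a => a \in K)) /=.
rewrite [X in _ = _ + X]big1 ?addr0; last by move=> a /negbTE ->; rewrite scale0r.
rewrite -[RHS]big_filter.
transitivity (\sum_(a <- [seq a <- enum_fset (AI `|` AE)%fset | a \in K]) c a *: a).
  apply: perm_big; apply: uniq_perm; rewrite ?filter_uniq ?fset_uniq // => a.
  by rewrite in_fsetI mem_filter andbC.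
by apply: eq_big_seq => a; rewrite mem_filter => /andP[->].
Qed.

End generators.

Section multiplier_index.
Context {R : realType} (d n m l : nat) (p : 'I_l -> nat).
Context (h : 'rV[R]_d -> 'rV[R]_m) (Phi : forall i : 'I_l, 'rV[R]_d -> 'rV[R]_(p i)).

Local Notation gen_index := {i : 'I_l & 'rV[R]_(p i)}.
Local Notation Gen i a := (Tagged (fun j : 'I_l => 'rV[R]_(p j)) (i := i) a).

(* One index for each vector that may occur in [RCPLD_family]. *)
Definition mult_index : choiceType := ('I_n + 'I_m + gen_index)%type.

Definition mult_vector (x : 'rV[R]_d) (v : 'I_n -> 'rV[R]_d) (t : mult_index) :
    'rV[R]_d :=
  match t with
  | inl (inl i) => v i
  | inl (inr j) => gradient h x j
  | inr s => adjoint_jacobian (Phi (tag s)) x (tagged s)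
  end.

Definition index_seq (I : {set 'I_n}) (J : {set 'I_m})
    (K : forall i, {fset 'rV[R]_(p i)}) : seq mult_index :=
  [seq inl (inl i) | i <- enum I] ++ [seq inl (inr j) | j <- enum J] ++
  flatten [seq [seq inr (Gen i a) | a <- enum_fset (K i)] | i <- enum 'I_l].

Lemma RCPLD_familyE I J (AI AE : forall i : 'I_l, {fset 'rV[R]_(p i)}) x v :
  RCPLD_family h Phi I J AI AE x v =
  [seq mult_vector x v t | t <- index_seq I J (fun i => AI i `|` AE i)%fset].
Proof.
rewrite /RCPLD_family /index_seq !map_cat -!map_comp map_flatten -map_comp.
congr (_ ++ (_ ++ flatten _)); apply: eq_map => i /=.
by rewrite -map_comp.
Qed.

Lemma mem_index_seq I J (K : forall i, {fset 'rV[R]_(p i)}) (t : mult_index) :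
  (t \in index_seq I J K) = match t with
  | inl (inl i) => i \in I
  | inl (inr j) => j \in J
  | inr s => tagged s \in K (tag s)
  end.
Proof.
have memGen (i : 'I_l) (a : 'rV[R]_(p i)) : (inr (Gen i a) \in flatten
    [seq [seq (inr (Gen i a) : mult_index) | a <- enum_fset (K i)] | i <- enum 'I_l])
    = (a \in K i).
  apply/flattenP/idP => [[_ /mapP [j _ ->] /mapP [b bK]]|aK].
    move=> /(congr1 (fun t : mult_index => if t is inr s then s else Gen i a)) /= E.
    have : tagged (Gen j b) \in K (tag (Gen j b)) by [].
    by rewrite -E.
  exists [seq inr (Gen i a) | a <- enum_fset (K i)]; last exact: map_f.
  by apply: map_f; rewrite mem_enum.
rewrite !mem_cat; case: t => [[i|j]|[i a]] /=.
- rewrite mem_map => [|a b [] //]; rewrite mem_enum.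
  case: (i \in I) => //=; apply/negP => /orP[/mapP [] //|].
  by move=> /flattenP [_ /mapP [j _ ->] /mapP []].
- have -> : (inl (inr j) \in [seq inl (inl i) : mult_index | i <- enum I]) = false.
    by apply/negP => /mapP [].
  rewrite mem_map => [|a b [] //]; rewrite mem_enum.
  case: (j \in J) => //=; apply/negP.
  by move=> /flattenP [_ /mapP [i _ ->] /mapP []].
rewrite memGen; case: (a \in K i); rewrite ?orbT // orbF.
by apply/negP => /orP[] /mapP [].
Qed.

Lemma index_seq_uniq I J K : uniq (index_seq I J K).
Proof.
have uGen (r : seq 'I_l) : uniq r ->
    uniq (flatten [seq [seq (inr (Gen i a) : mult_index) | a <- enum_fset (K i)] | i <- r]).
  elim: r => //= i r IH /andP[ir /IH ur]; rewrite cat_uniq ur andbT.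
  rewrite map_inj_uniq ?fset_uniq => [|a b]; last first.
    move=> /(congr1 (fun t : mult_index => if t is inr s then s else Gen i a)) /=.
    exact: eq_from_Tagged.
  apply/hasPn => _ /flattenP [_ /mapP [j jr ->] /mapP [b _ ->]].
  apply/negP => /mapP [a _].
  move=> /(congr1 (fun t : mult_index => if t is inr s then tag s else i)) /= ji.
  by move: ir; rewrite -ji jr.
rewrite /index_seq !cat_uniq uGen ?enum_uniq // andbT.
rewrite !map_inj_uniq ?enum_uniq; try by move=> a b [].
rewrite /=; apply/andP; split.
  apply/hasPn => t; rewrite mem_cat => /orP[/mapP [j _ ->]|].
    by apply/negP => /mapP [].
  by move=> /flattenP [_ /mapP [j _ ->] /mapP [b _ ->]]; apply/negP => /mapP [].
apply/hasPn => t /flattenP [_ /mapP [j _ ->] /mapP [b _ ->]].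
by apply/negP => /mapP [].
Qed.

Lemma sum_index_seq (V : nmodType) I J K (F : mult_index -> V) :
  \sum_(t <- index_seq I J K) F t = \sum_(i in I) F (inl (inl i)) +
    \sum_(j in J) F (inl (inr j)) +
    \sum_i \sum_(a <- enum_fset (K i)) F (inr (Gen i a)).
Proof.
rewrite /index_seq !big_cat /= !big_map !big_enum addrA; congr (_ + _).
rewrite big_flatten big_map big_enum; apply: eq_bigr => i _.
by rewrite big_map.
Qed.

Definition kept_g (s : seq mult_index) : {set 'I_n} := [set i | inl (inl i) \in s].

Definition kept_gen (K : forall i, {fset 'rV[R]_(p i)}) (s : seq mult_index) i :
    {fset 'rV[R]_(p i)} :=
  [fset a in K i | inr (Gen i a) \in s]%fset.

(** The gradients in [J] are the block kept whole. The mask concerns only subgradients and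
    generators, and signs survive on the subgradients and on [AI]. *)
Lemma caratheodory_multipliers (x : 'rV[R]_d) (v : 'I_n -> 'rV[R]_d)
    (Act : {set 'I_n}) (J : {set 'I_m}) (AI AE : forall i : 'I_l, {fset 'rV[R]_(p i)})
    (lam : 'rV[R]_n) (u : 'rV[R]_d) (eta : forall i : 'I_l, 'rV[R]_(p i))
    (s2 := index_seq Act finset.set0 (fun i => AI i `|` AE i)%fset) :
  (forall i, [disjoint AI i & AE i]%fset) ->
  free [seq gradient h x j | j <- enum J] ->
  u \in <<[seq gradient h x j | j <- enum J]>>%VS ->
  (forall i, 0 <= lam 0 i) ->
  (forall i, cone_plus_span (AI i) (AE i) (eta i)) ->
  exists (b : (size s2).-tuple bool) (c : mult_index -> R)
    (S := index_seq (kept_g (mask b s2)) J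
      (kept_gen (fun i => AI i `|` AE i)%fset (mask b s2))), [/\
    free [seq mult_vector x v t | t <- S],
    \sum_(i in Act) lam 0 i *: v i + u
      + \sum_i adjoint_jacobian (Phi i) x (eta i) =
      \sum_(t <- S) c t *: mult_vector x v t,
    forall i, i \in kept_g (mask b s2) -> 0 <= c (inl (inl i)) &
    forall i a, a \in kept_gen (fun i => AI i `|` AE i)%fset (mask b s2) i ->
      a \in AI i -> 0 <= c (inr (Gen i a))].
Proof.
move=> dA fJ uJ lam0 etaC.
pose H (i : 'I_l) := cid ((cone_plus_spanP _ (dA i)).1 (etaC i)).
have [e ue] := span_mapP (enum_uniq J) uJ.
pose c0 (t : mult_index) := match t with
  | inl (inl i) => lam 0 i
  | inl (inr j) => e j
  | inr s => sval (H (tag s)) (tagged s) end.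
pose s1 := index_seq finset.set0 J (fun=> fset0).
have us : uniq (s1 ++ s2).
  rewrite cat_uniq !index_seq_uniq andbT /=; apply/hasPn => t.
  by rewrite !mem_index_seq; case: t => [[i|j]|s]; rewrite !inE.
have s1E w : [seq mult_vector x w t | t <- s1] = [seq gradient h x j | j <- enum J].
  rewrite /s1 /index_seq enum_set0 /= map_cat -map_comp.
  rewrite (_ : flatten _ = [::]) ?cats0 //.
  by elim: (enum 'I_l).
have fs1 : free [seq mult_vector x v t | t <- s1] by rewrite s1E.
have [b [c [sb [fb cE c_ge0]]]] := caratheodory c0 us fs1.
have /eqP sb' := sb; exists (Tuple sb'), c => S /=.
(* [S] regroups the kept indices in the order of [RCPLD_family]; only the order differs. *)
have perm : perm_eq (s1 ++ mask b s2) S.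
  apply: uniq_perm; last move=> t.
  - move: us; rewrite !(cat_uniq s1) => /and3P[us1 /hasPn s12 us2].
    by rewrite us1 mask_uniq // andbT; apply/hasPn => t /mem_mask; exact: s12.
  - exact: index_seq_uniq.
  rewrite mem_cat /S !mem_index_seq; case: t => [[i|j]|[i a]] /=.
  - by rewrite !inE.
  - case: (j \in J) => //=; apply/negP => /mem_mask.
    by rewrite mem_index_seq inE.
  - rewrite !inE /=; apply/idP/andP => [H1|[] //]; split=> //.
    by have := mem_mask H1; rewrite mem_index_seq /= in_fsetU.
split.
- by rewrite -(perm_free (perm_map _ perm)).
- rewrite -(perm_big _ perm) -cE /= big_cat /= !sum_index_seq !big_set0 add0r.
  rewrite [X in _ = (_ + X) + _]big1 ?addr0 => [|i _]; last by rewrite big_nil.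
  have -> : \sum_(j in J) c0 (inl (inr j)) *: mult_vector x v (inl (inr j)) = u.
    by rewrite ue big_enum.
  rewrite addrA (addrC u); congr (_ + _).
  apply: eq_bigr => i _; rewrite [in LHS]((svalP (H i)).2) adjoint_jacobian_sum.
  by apply: eq_bigr => a _; rewrite adjoint_jacobianZ.
- by move=> i; rewrite inE => ib; apply: c_ge0 => //=; exact: lam0.
move=> i a; rewrite !inE /= => /andP[_ ab] aI; apply: c_ge0 => //=.
by have [+ _] := svalP (H i); exact.
Qed.

End multiplier_index.

(** * Limit of the normalized reduced multipliers *)

Theorem theorem3p1 (R : realType) (d n m l : nat) (p : 'I_l -> nat)
  (f : 'rV[R]_d -> R)
  (g : 'rV[R]_d -> 'rV[R]_n) (h : 'rV[R]_d -> 'rV[R]_m)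
  (Phi : forall i : 'I_l, 'rV[R]_d -> 'rV[R]_(p i))
  (Gamma : forall i : 'I_l, set 'rV[R]_(p i))
  (gen : generator_choice R) (delta : 'I_l -> R) (xbar : 'rV[R]_d) :
  locally_lipschitz g ->
  continuously_differentiable h ->
  (forall i, continuously_differentiable (Phi i)) ->
  (forall i, disjunctive_set (Gamma i)) ->
  (forall i, generator_choice_for gen (Gamma i)) ->
  (forall i, normal_radius (Gamma i) (Phi i xbar) (delta i)) ->
  lipschitz_near f xbar ->
  local_solution f (feasible g h Phi Gamma) xbar ->
  MPDC_RCPLD g h Phi Gamma gen delta xbar ->
  M_stationary f g h Phi Gamma xbar.
Proof.
move=> g_lip h_C1 Phi_C1 Gamma_disj gen_ok radius f_lip xbar_sol [rank_cst rcpld].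
have [U [UU ooU]] := @ultraFilterLemma nat \oo _.
have PU : ProperFilter U by exact: ultra_proper.
have FU : Filter U by exact: filter_filter.
have [x [z [eta [lam [mu [v0 [v [xlim zlim ps]]]]]]]] :=
  penalty_sequence g_lip h_C1 Phi_C1 Gamma_disj f_lip xbar_sol ooU.
have [[gbar _ Gbar] _] := xbar_sol.
have [xbarU|xneq] := @ultra_dichotomy _ U _ (fun k => x k = xbar).
  have [k [xk psk]] := near_ex2 xbarU ps; have [lam_k mu_k eta_k] := ps_center psk xk.
  exists 0, 0, (fun=> 0); split; last 2 first.
  - by move=> i _; rewrite mxE.
  - move=> i; apply: limiting_normal_of_regular => // e e0.
    by exists (Phi i xbar); [rewrite subrr normr0 ltW | exact: regular_normal0].
  exists (v0 k), (v k); split.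
  - by rewrite -xk; exact: ps_f psk.
  - by move=> i _; rewrite -xk; exact: ps_g psk i.
  have := ps_eq psk; rewrite xk subrr scaler0 addr0 lam_k mu_k => eq0.
  rewrite -[LHS]eq0; congr (_ + _ + _ + _).
  - rewrite !big1 // => i _; by rewrite mxE scale0r.
  - by rewrite -sum_gradient.
  - by apply: eq_bigr => i _; rewrite eta_k.
(* Stated for [U]-most reference indices [k0], so that [k0] can at once satisfy stationarity and
   have [z k0 i] in the ball of radius [delta i]. *)
have coneU : \forall k0 \near U, forall i, \forall k \near U,
    regular_normal_cone (Gamma i) (z k i) = regular_normal_cone (Gamma i) (z k0 i).
  apply: filter_forall => i.
  have [Y [tau tauP]] := regular_normal_cones_finite (Gamma_disj i).
  have [y yP] := @ultra_constant _ U _ _ (fun k => tau (z k i)).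
  have [ps' yP'] := (ps, yP).
  apply: filterS2 ps yP => k0 psk0 tk0; apply: filterS2 ps' yP' => k psk tk.
  apply: tauP; rewrite ?tk //; first by have [] := ps_normal psk i.
  by have [] := ps_normal psk0 i.
(* This places the generators of the cone at [z k0 i] in [AI_at] and [AE_at]. *)
have zball : \forall k \near U, forall i, ball (Phi i xbar) (delta i) (z k i).
  apply: filter_forall => i; have [d0 _] := radius i.
  by have /cvgrPdist_lt /(_ _ d0) := zlim i; rewrite -ball_normE.
have [k0 [coneE psk0 zk0]] := near_ex3 coneU ps zball.
pose D i := regular_normal_cone (Gamma i) (z k0 i).
have Gzk0 i : Gamma i (z k0 i) by have [] := ps_normal psk0 i.
pose AI i := (gen (p i) (D i)).1; pose AE i := (gen (p i) (D i)).2.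
have [dA DE] : (forall i, [disjoint AI i & AE i]%fset) /\
    forall i, D i = cone_plus_span (AI i) (AE i).
  by split=> i; have [[]] := gen_ok i _ (Gzk0 i).
have D_limiting i : D i `<=` limiting_normal_cone (Gamma i) (Phi i xbar).
  move=> u uD; apply: limiting_normal_of_regular => // e e0.
  have /cvgrPdist_le /(_ e e0) zi := zlim i.
  have [k [kz kD]] := near_ex2 zi (coneE i).
  by exists (z k i); [rewrite distrC | rewrite kD].
have [J basisJ] := basis_subfamily (fun j => gradient h xbar j).
pose Act := active g xbar.
have grad_lim j : (fun k => gradient h (x k) j) @ U --> gradient h xbar j.
  have gE y : gradient h y j = adjoint_jacobian h y (delta_mx 0 j).
    rewrite -sum_gradient (bigD1 j) //= big1 ?addr0 => [|i ij].
      by rewrite mxE !eqxx scale1r.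
    by rewrite mxE (negbTE ij) andbF scale0r.
  rewrite gE; under eq_fun do rewrite gE.
  exact: cvg_adjoint_jacobian.
have freeJ : \forall k \near U, free [seq gradient h (x k) j | j <- enum J].
  apply: (free_map_limit (enum_uniq J) (fun j _ => grad_lim j)).
  exact: basis_free basisJ.
have spanJ : \forall k \near U, adjoint_jacobian h (x k) (mu k) \in
    <<[seq gradient h (x k) j | j <- enum J]>>%VS.
  have rankU : \forall k \near U, \dim <<[seq gradient h (x k) i | i <- enum 'I_m]>> =
      \dim <<[seq gradient h xbar i | i <- enum 'I_m]>> by exact: xlim rank_cst.
  apply: filterS2 freeJ rankU => k fk rk.
  have := span_constant_rank basisJ rk fk (fun j => mu k 0 j).
  by rewrite sum_gradient.
(* A nonzero multiplier requires [g i] positive at [x k], while an inactive [g i] stays negative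
   near [xbar]. *)
have inactive : \forall k \near U, forall i, i \notin Act -> lam k 0 i = 0.
  apply: filter_forall => i; have [iA|iA] := boolP (i \in Act).
    by apply: filterE.
  have gi : g xbar 0 i < 0.
    by rewrite lt_neqAle gbar andbT; move: iA; rewrite inE.
  have glim : (fun k => g (x k) 0 i) @ U --> g xbar 0 i.
    exact: (@cvg_comp _ _ _ x (fun y => g y 0 i) _ _ _ xlim
      (lipschitz_near_continuous (lipschitz_near_coord g_lip xbar i))).
  apply: filterS2 ps (cvgr_lt _ glim _ gi) => k psk gk _.
  apply/eqP; apply: contraTT gk => /(ps_active psk) gk.
  by rewrite -leNgt ltW.
pose K i := (AI i `|` AE i)%fset.
pose s2 := index_seq Act (finset.set0 : {set 'I_m}) K.
pose good k := [/\ perturbed_stationary f g h Phi Gamma xbar (x k) (z k) (eta k)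
      (lam k) (mu k) (v0 k) (v k),
    forall i, regular_normal_cone (Gamma i) (z k i) = D i,
    free [seq gradient h (x k) j | j <- enum J],
    adjoint_jacobian h (x k) (mu k) \in <<[seq gradient h (x k) j | j <- enum J]>>%VS &
    forall i, i \notin Act -> lam k 0 i = 0].
have /choice [bc bcP] (k : nat) :
    exists bc : (size s2).-tuple bool * (mult_index n m p -> R),
    good k ->
    let S := index_seq (kept_g (mask bc.1 s2)) J (kept_gen K (mask bc.1 s2)) in
    [/\ free [seq mult_vector h Phi (x k) (v k) t | t <- S],
    v0 k + \sum_(t <- S) bc.2 t *: mult_vector h Phi (x k) (v k) t
      + 2 *: (x k - xbar) = 0,
    forall i, i \in kept_g (mask bc.1 s2) -> 0 <= bc.2 (inl (inl i)) &
    forall i a, a \in kept_gen K (mask bc.1 s2) i -> a \in AI i ->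
      0 <= bc.2 (inr (Tagged (fun j : 'I_l => 'rV[R]_(p j)) a))].
  have b0 : (size s2).-tuple bool by exact: [tuple of nseq (size s2) false].
  have [H|nH] := pselect (good k); last by exists (b0, fun=> 0).
  have [psk Dk fk sk ik] := H.
  have etaD i : cone_plus_span (AI i) (AE i) (eta k i).
    by rewrite -DE -Dk; exact: ps_normal psk i.
  have [b [c [fS cE c_g c_gen]]] := caratheodory_multipliers Phi (v k) Act dA fk sk
    (ps_ge0 psk) etaD.
  exists (b, c) => _ /=; split=> //.
  have lamE : \sum_i lam k 0 i *: v k i = \sum_(i in Act) lam k 0 i *: v k i.
    rewrite (bigID (fun i => i \in Act)) /= [X in _ + X]big1 ?addr0 // => i iA.
    by rewrite ik // scale0r.
  by rewrite -cE -[RHS](ps_eq psk) lamE !addrA.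
have goodU : \forall k \near U, good k.
  have coneE' : \forall k \near U, forall i, regular_normal_cone (Gamma i) (z k i) = D i.
    by apply: filter_forall => i; exact: coneE.
  have c1 := @near_and _ _ FU _ _ ps coneE'.
  have c2 := @near_and _ _ FU _ _ freeJ spanJ.
  by apply: filterS3 c1 c2 inactive => k [? ?] [? ?] ?; split.
(* Finitely many masks: one subfamily [S] is kept along all of [U]. *)
have [b bE] := @ultra_constant _ U _ _ (fun k => (bc k).1).
pose I := kept_g (mask b s2); pose K' := kept_gen K (mask b s2).
pose S := index_seq I J K'; pose c k := (bc k).2.
pose Gen i a : mult_index n m p := inr (Tagged (fun j : 'I_l => 'rV[R]_(p j)) (i := i) a).
pose red k := [/\ perturbed_stationary f g h Phi Gamma xbar (x k) (z k) (eta k)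
      (lam k) (mu k) (v0 k) (v k),
    free [seq mult_vector h Phi (x k) (v k) t | t <- S],
    v0 k + \sum_(t <- S) c k t *: mult_vector h Phi (x k) (v k) t
      + 2 *: (x k - xbar) = 0,
    forall i, i \in I -> 0 <= c k (inl (inl i)) &
    forall i a, a \in K' i -> a \in AI i -> 0 <= c k (Gen i a)].
have redU : \forall k \near U, red k.
  apply: filterS2 goodU bE => k gk bk; have := bcP k gk; rewrite bk => -[? ? ? ?].
  by split=> //; have [] := gk.
(* [rho k] is the weight of [f] after normalization, [r] its limit. *)
pose rho k := (1 + \sum_(t <- S) `|c k t|)^-1.
have M0 k : 0 <= \sum_(t <- S) `|c k t| by exact: sumr_ge0.
have D0 k : 0 < 1 + \sum_(t <- S) `|c k t| by rewrite ltr_wpDr.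
have rho0 k : 0 < rho k by rewrite invr_gt0.
(* Cut off outside [S] so that every index, kept or not, has bounded coefficients. *)
pose a k t := if t \in S then rho k * c k t else 0.
have a1 k t : `|a k t| <= 1.
  rewrite /a; case: ifP => [tS|]; last by rewrite normr0.
  rewrite normrM gtr0_norm // mulrC ler_pdivrMr // mul1r (big_rem t) //= addrCA.
  by rewrite lerDl addr_ge0 // sumr_ge0.
have rho_a k : rho k + \sum_(t <- S) `|a k t| = 1.
  have -> : \sum_(t <- S) `|a k t| = rho k * \sum_(t <- S) `|c k t|.
    rewrite mulr_sumr; apply: eq_big_seq => t tS.
    by rewrite /a tS normrM gtr0_norm.
  by rewrite -[X in X + _]mulr1 -mulrDr mulVf // gt_eqF.
have rho1 k : `|rho k| <= 1.
  rewrite gtr0_norm // -(rho_a k) lerDl; exact: sumr_ge0.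
have [r _ rlim] := @ultra_bounded_cvgR _ U _ _ rho 1 (filterE _ rho1).
have [C Clim] := @ultra_coef_cvg _ _ U _ _ a (fun t => filterE _ (fun k => a1 k t)).
have [v0bar v0lim v0barP] : exists2 v0bar, v0 @ U --> v0bar &
    limiting_subdifferential f xbar v0bar.
  have [L [rL [L0 rL0 lipL]]] := lipschitz_nearP f_lip.
  have bnd : \forall k \near U, `|v0 k| <= L.
    have /cvgrPdist_lt /(_ rL rL0) xr := xlim.
    apply: filterS2 ps xr => k psk; rewrite distrC => xk.
    exact: limiting_subdifferential_bound (ltW L0) lipL xk (ps_f psk).
  have [v0bar _ v0lim] := ultra_bounded_cvg bnd; exists v0bar => //.
  apply: limiting_subdifferential_closed (lipschitz_near_continuous f_lip) xlim v0lim _.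
  by apply: filterS ps => k; exact: ps_f.
have [vbar vlim vbarP] : exists2 vbar : 'I_n -> 'rV[R]_d,
    forall i, (fun k => v k i) @ U --> vbar i &
    forall i, limiting_subdifferential (fun y => g y 0 i) xbar (vbar i).
  have /choice [vbar vbarP] i : exists vb, (fun k => v k i) @ U --> vb /\
      limiting_subdifferential (fun y => g y 0 i) xbar vb.
    have gi_lip := lipschitz_near_coord g_lip xbar i.
    have [L [rL [L0 rL0 lipL]]] := lipschitz_nearP gi_lip.
    have bnd : \forall k \near U, `|v k i| <= L.
      have /cvgrPdist_lt /(_ rL rL0) xr := xlim; have ps' := ps.
      apply: filterS2 ps' xr => k psk; rewrite distrC => xk.
      exact: limiting_subdifferential_bound (ltW L0) lipL xk (ps_g psk i).
    have [vb _ vblim] := ultra_bounded_cvg bnd; exists vb; split=> //.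
    apply: limiting_subdifferential_closed (lipschitz_near_continuous gi_lip) xlim vblim _.
    by apply: filterS ps => k psk; exact: ps_g psk i.
  by exists vbar => i; have [] := vbarP i.
pose w := mult_vector h Phi xbar vbar.
have wlim t : (fun k => mult_vector h Phi (x k) (v k) t) @ U --> w t.
  case: t => [[i|j]|s] /=; [exact: vlim | exact: grad_lim |].
  exact: cvg_adjoint_jacobian.
(* The normalization survives the limit: if [r = 0], some [C t] is nonzero. *)
have norm1 : r + \sum_(t <- S) `|C t| = 1.
  have lim : (fun k => rho k + \sum_(t <- S) `|a k t|) @ U --> r + \sum_(t <- S) `|C t|.
    by apply: cvgD => //; apply: cvg_sum => t _; apply: cvg_norm; exact: Clim.
  have lim1 : (fun k => rho k + \sum_(t <- S) `|a k t|) @ U --> (1 : R).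
    by under eq_fun do rewrite rho_a; exact: cvg_cst.
  exact: cvg_unique lim lim1.
have limeq : r *: v0bar + \sum_(t <- S) C t *: w t = 0.
  have lim : (fun k => rho k *: v0 k
      + \sum_(t <- S) a k t *: mult_vector h Phi (x k) (v k) t
      + rho k *: (2 *: (x k - xbar))) @ U -->
      r *: v0bar + \sum_(t <- S) C t *: w t + r *: (2 *: (xbar - xbar)).
    apply: cvgD; first apply: cvgD; first exact: cvgZ.
      by apply: cvg_sum => t _; apply: cvgZ; [exact: Clim | exact: wlim].
    apply: cvgZ => //; apply: cvgZ; first exact: cvg_cst.
    by apply: cvgB => //; exact: cvg_cst.
  have z0 : r *: (2 *: (xbar - xbar)) = 0 by rewrite subrr !scaler0.
  transitivity (r *: v0bar + \sum_(t <- S) C t *: w t + r *: (2 *: (xbar - xbar))).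
    by rewrite z0 addr0.
  have redU' := redU; apply: (cvg_unique (@norm_hausdorff _ _) lim).
  apply: cvg_near_cst.
  apply: filterS redU' => k [_ _ eqk _ _].
  transitivity (rho k *: (v0 k + \sum_(t <- S) c k t *: mult_vector h Phi (x k) (v k) t
      + 2 *: (x k - xbar))); last by rewrite eqk scaler0.
  rewrite !(scalerDr (rho k)); congr (_ + _ + _).
  rewrite scaler_sumr; apply: eq_big_seq => t tS.
  by rewrite /a tS scalerA.
have r_ge0 : 0 <= r by apply: (cvgr_to_ge rlim); apply: filterE => k; exact: ltW.
have C_ge0 t : (\forall k \near U, t \in S -> 0 <= c k t) -> t \in S -> 0 <= C t.
  move=> ct tS; apply: (cvgr_to_ge (Clim t)); apply: filterS ct => k /(_ tS) ckt.
  by rewrite /a tS mulr_ge0 // ltW.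
have CI i : i \in I -> 0 <= C (inl (inl i)).
  move=> iI; apply: C_ge0; last by rewrite mem_index_seq.
  by have redU' := redU; apply: filterS redU' => k [_ _ _ + _] _; exact.
have CK i u : u \in K' i -> u \in AI i -> 0 <= C (Gen i u).
  move=> uK uA; apply: C_ge0; last by rewrite mem_index_seq.
  by have redU' := redU; apply: filterS redU' => k [_ _ _ _ H] _; exact: H.
have IAct : I \subset Act.
  apply/fintype.subsetP => i; rewrite inE => /mem_mask.
  by rewrite mem_index_seq.
pose etaC i := \sum_(u <- enum_fset (K' i)) C (Gen i u) *: u.
have K'E i : ((AI i `&` K' i) `|` (AE i `&` K' i) = K' i)%fset.
  rewrite -fsetIUl; apply/fsetP => u; rewrite in_fsetI /K' /kept_gen !inE /=.
  by case: (_ || _).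
have etaC_cone i s : 0 <= s ->
    cone_plus_span (AI i `&` K' i)%fset (AE i `&` K' i)%fset (s *: etaC i).
  move=> s0; apply/cone_plus_spanP; first exact: fdisjoint_restrict.
  exists (fun u => s * C (Gen i u)); split=> [u|].
    by rewrite in_fsetI => /andP[uA uK]; rewrite mulr_ge0 // CK.
  by rewrite K'E scaler_sumr; apply: eq_bigr => u _; rewrite scalerA.
have cone_limiting i : cone_plus_span (AI i `&` K' i)%fset (AE i `&` K' i)%fset `<=`
    limiting_normal_cone (Gamma i) (Phi i xbar).
  move=> u uC; apply: D_limiting; rewrite DE.
  exact: (cone_plus_span_restrict (dA i) uC).
have sumE : \sum_(t <- S) C t *: w t = \sum_(i in I) C (inl (inl i)) *: vbar i
    + \sum_(j in J) C (inl (inr j)) *: gradient h xbar j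
    + \sum_i adjoint_jacobian (Phi i) xbar (etaC i).
  rewrite sum_index_seq; congr (_ + _); apply: eq_bigr => i _.
  rewrite /etaC adjoint_jacobian_sum; apply: eq_bigr => u _.
  by rewrite adjoint_jacobianZ.
(* For [r > 0], dividing by [r] gives stationarity, with multiplier zero at every dropped index. *)
have [r0|rn0] := eqVneq r 0; last first.
  have r_gt0 : 0 < r by rewrite lt_neqAle eq_sym rn0.
  have ri0 : 0 <= r^-1 by rewrite invr_ge0.
  exists (\row_i (if i \in I then r^-1 * C (inl (inl i)) else 0)),
    (\row_j (if j \in J then r^-1 * C (inl (inr j)) else 0)),
    (fun i => r^-1 *: etaC i); split.
  - exists v0bar, vbar; split=> //.
    have -> : \sum_(i in active g xbar)
        (\row_i (if i \in I then r^-1 * C (inl (inl i)) else 0)) 0 i *: vbar i =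
        r^-1 *: \sum_(i in I) C (inl (inl i)) *: vbar i.
      rewrite scaler_sumr [LHS]big_mkcond [RHS]big_mkcond; apply: eq_bigr => i _.
      rewrite mxE; case: (boolP (i \in I)) => [iI|_]; last by rewrite scale0r if_same.
      by rewrite (fintype.subsetP IAct _ iI) scalerA.
    have -> : \sum_(j < m) (\row_j (if j \in J then r^-1 * C (inl (inr j)) else 0)) 0 j
        *: gradient h xbar j = r^-1 *: \sum_(j in J) C (inl (inr j)) *: gradient h xbar j.
      rewrite scaler_sumr [RHS]big_mkcond; apply: eq_bigr => j _.
      by rewrite mxE; case: ifP; rewrite ?scale0r ?scalerA.
    have -> : \sum_(i < l) adjoint_jacobian (Phi i) xbar (r^-1 *: etaC i) =
        r^-1 *: \sum_i adjoint_jacobian (Phi i) xbar (etaC i).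
      by rewrite scaler_sumr; apply: eq_bigr => i _; rewrite adjoint_jacobianZ.
    have := congr1 (fun u => r^-1 *: u) limeq.
    by rewrite scaler0 sumE !(scalerDr r^-1) scalerA mulVf // scale1r !addrA.
  - by move=> i _; rewrite mxE; case: ifP => // iI; rewrite mulr_ge0 // CI.
  - by move=> i; apply: cone_limiting; exact: etaC_cone.
exfalso.
(* MPDC-RCPLD speaks of sequences along [\oo]; picking, for each [N], an index within [1 / (N + 1)]
   of the limits turns convergence along [U] into such a sequence. *)
have near_all (e : R) : 0 < e -> exists k, [/\ `|x k - xbar| <= e, x k <> xbar,
    forall i, `|v k i - vbar i| <= e & red k].
  move=> e0.
  have vnear : \forall k \near U, forall i, `|v k i - vbar i| <= e.
    apply: filter_forall => i; have /cvgrPdist_le /(_ e e0) := vlim i.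
    by apply: filterS => k; rewrite distrC.
  have /cvgrPdist_le /(_ e e0) xe := xlim.
  have [k [[xk xn] vk rk]] := near_ex3 (@near_and _ _ FU _ _ xe xneq) vnear redU.
  by exists k; rewrite distrC.
have /choice [ka kaP] (N : nat) : exists k, [/\ `|x k - xbar| <= N.+1%:R^-1, x k <> xbar,
    forall i, `|v k i - vbar i| <= N.+1%:R^-1 & red k].
  by apply: near_all; rewrite invr_gt0.
have [k1 [_ _ _ [_ freeS _ _ _]]] := near_all 1 ltr01.
(* A linear dependency among the generators would be carried by [adjoint_jacobian] to their images
   at [x k1], which are independent. *)
have freeK i : free (enum_fset (K' i)).
  have uG : uniq [seq Gen i u | u <- enum_fset (K' i)].
    rewrite map_inj_uniq ?fset_uniq // => u u'.
    move=> /(congr1 (fun t : mult_index n m p => if t is inr s then s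
      else Tagged (fun j : 'I_l => 'rV[R]_(p j)) u)).
    exact: eq_from_Tagged.
  have subS : {subset [seq Gen i u | u <- enum_fset (K' i)] <= S}.
    by move=> _ /mapP [u uK ->]; rewrite mem_index_seq.
  have := free_map_sub uG (index_seq_uniq _ _ _) subS freeS.
  rewrite -map_comp => /(free_mapP _ (fset_uniq (K' i))) fG.
  rewrite -[enum_fset _]map_id; apply/(free_mapP _ (fset_uniq (K' i))) => e e0.
  apply: fG; have := congr1 (adjoint_jacobian (Phi i) (x k1)) e0.
  rewrite adjoint_jacobian_sum [adjoint_jacobian _ _ 0]mul0mx => e1.
  rewrite -[RHS]e1; apply: eq_bigr => u _.
  by rewrite adjoint_jacobianZ.
(* By independence a zero multiplier has zero coefficients; if all limit multipliers were zero,
   [norm1] would fail at [r = 0]. *)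
have etaC0 i : etaC i = 0 -> forall u, u \in K' i -> C (Gen i u) = 0.
  move=> e0 u uK; have := (free_mapP id (fset_uniq (K' i))).1.
  rewrite map_id => /(_ (freeK i) (fun u => C (Gen i u))); exact.
(* MPDC-RCPLD asks for empty generator sets where the multiplier vanishes; a
   subfamily of a free family is still free. *)
pose AI' i := if etaC i == 0 then fset0 else (AI i `&` K' i)%fset.
pose AE' i := if etaC i == 0 then fset0 else (AE i `&` K' i)%fset.
have AU' i : (AI' i `|` AE' i = if etaC i == 0 then fset0 else K' i)%fset.
  by rewrite /AI' /AE'; case: ifP => _; rewrite ?fsetU0.
have dep := rcpld J basisJ I (\row_j (if j \in J then C (inl (inr j)) else 0))
  (\row_i (if i \in I then C (inl (inl i)) else 0)) etaC vbar IAct.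
have : \forall N \near \oo, ~~ free (RCPLD_family h Phi I J AI' AE' (x (ka N)) (v (ka N))).
  apply: dep.
  - move=> [/rowP lh /rowP lg e0].
    have : \sum_(t <- S) `|C t| = 0.
      rewrite big_seq big1 // => t; rewrite mem_index_seq.
      case: t => [[i|j]|[i u]] /= tS; apply/eqP; rewrite normr_eq0; apply/eqP.
      + by have := lg i; rewrite !mxE tS.
      + by have := lh j; rewrite !mxE tS.
      + exact: etaC0 (e0 i) _ tS.
    by move=> C0; move/eqP: norm1; rewrite r0 C0 addr0 eq_sym oner_eq0.
  - by move=> j jJ; rewrite mxE (negbTE jJ).
  - by move=> i iI; rewrite mxE (negbTE iI).
  - by move=> i; rewrite mxE; case: ifP => // iI; exact: CI.
  - by move=> i _; exact: vbarP.
  - by move=> i; apply: cone_limiting; rewrite -[etaC i]scale1r; exact: etaC_cone.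
  - have := limeq; rewrite r0 scale0r add0r sumE => eq0; rewrite -[LHS]eq0.
    congr (_ + _ + _).
      by apply: eq_bigr => i iI; rewrite mxE iI.
    by apply: eq_bigr => j jJ; rewrite mxE jJ.
  - by apply: cvg_natSinv => // N; have [] := kaP N.
  - by move=> N; have [] := kaP N.
  - by move=> N i _; have [_ _ _ [psk _ _ _ _]] := kaP N; exact: ps_g psk i.
  - by move=> i _; apply: cvg_natSinv => // N; have [_ _ /(_ i)] := kaP N.
  - move=> i u; rewrite /AI' /=; case: ifP => // _; rewrite in_fsetI => /andP[uA _].
    by exists (z k0 i).
  - move=> i u; rewrite /AE' /=; case: ifP => // _; rewrite in_fsetI => /andP[uA _].
    by exists (z k0 i).
  - move=> i /eqP/negbTE e0; rewrite AU' e0 /AI' /AE' e0; split=> //.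
    by rewrite -[etaC i]scale1r; exact: etaC_cone.
  - by move=> i e0; rewrite AU' e0 eqxx.
move=> /filter_ex [N]; apply/negP; rewrite negbK RCPLD_familyE.
have [_ _ _ [_ fN _ _ _]] := kaP N.
apply: free_map_sub fN; [exact: index_seq_uniq | exact: index_seq_uniq |].
move=> t; rewrite !mem_index_seq; case: t => [//|s]; rewrite AU'.
by case: ifP => // _; rewrite in_fset0.
Qed.
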